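(* Let $b$ be a contractive multiplier of $H^2_d$, $b\not\equiv 1$, and let $\mu$ be the state on $\mathcal S+\mathcal S^*$ representing $b$. Then the normalized NC Fantappiè transform, defined for polynomials $p\in\mathcal S$ by $$\mathcal V_\mu(p)(z) = (1-b(z))\,\mu\big((I-z\mathbf L^* )^{-1}p(\mathbf L)\big),\qquad z\in\mathbb B^d,$$ extends to a unitary operator from $P^2(\mu)$ onto $\mathcal H(b)$ (that is, $[p]\mapsto \mathcal V_\mu(p)$ is well defined and extends to such a unitary).
   Context: Fix an integer $d\ge 1$; $\mathbb B^d$ is the open unit ball of $\mathbb C^d$, $\lambda^*$ denotes the complex conjugate of a scalar, and $zw^*=\sum_{j=1}^d z_jw_j^*$. $H^2_d$ (Drury–Arveson space) is the reproducing kernel Hilbert space on $\mathbb B^d$ with kernel $\frac1{1-zw^*}$. A contractive multiplier $b$ is a holomorphic function on $\mathbb B^d$ with $bf\in H^2_d$ and $\|bf\|\le\|f\|$ for all $f\in H^2_d$; $\mathcal H(b)$ is the reproducing kernel Hilbert space with kernel $k^b(z,w)=\frac{1-b(z)b(w)^*}{1-zw^*}$. $\mathbb F_d^+$ is the free semigroup of finite words in $1,\dots,d$ (including the empty word); on $\ell^2(\mathbb F_d^+)$ with orthonormal basis $\{\xi_w\}$ put $L_i\xi_w=\xi_{iw}$, so $L_i^*L_j=\delta_{ij}I$. For $\mathbf n\in\mathbb N^d$ (nonnegative integers), $L^{(\mathbf n)}$ is the sum of all distinct words (products) in the $L_i$ containing exactly $n_i$ factors $L_i$ for each $i$; $L^{(\mathbf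 0)}=I$. $\mathcal S$ is the norm-closed linear span of all $L^{(\mathbf n)}$, and $\mathcal S^*$ is the set of adjoints of its elements. A polynomial $p\in\mathcal S$ (also written $p(\mathbf L)$) is a finite linear combination of the $L^{(\mathbf n)}$. Put $z\mathbf L^*=\sum_j z_jL_j^*$; for $z\in\mathbb B^d$, $I-z\mathbf L^*$ is invertible. A state on $\mathcal S+\mathcal S^*$ means a positive linear functional (not necessarily normalized), identified with its unique positive extension to the norm closure $\overline{\mathcal S+\mathcal S^*}$; for $p,q\in\mathcal S$ the operators $q^*p$ and $(I-z\mathbf L^* )^{-1}p$ lie in this closure. The state $\mu$ represents $b$ if $$\frac{1+b(z)}{1-b(z)}=\mu\big((I+z\mathbf L^* )(I-z\mathbf L^* )^{-1}\big)+i\,\mathrm{Im}\Big(\frac{1+b(0)}{1-b(0)}\Big),\quad z\in\mathbb B^d;$$ such a $\mu$ exists and is unique. $P^2(\mu)$ is the Hilbert space obtained from $\mathcal S$ with the pre-inner product $\langle p,q\rangle=\mu(q^*p)$ by quotienting null vectors and completing; $[p]$ is the class of $p$. *)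

(* Defs.v *)
From HB Require Import structures.
From mathcomp Require Import all_boot all_order all_algebra.
From mathcomp Require Import all_classical all_reals all_analysis.
From mathcomp Require Import complex sesquilinear ring.

Set Implicit Arguments.
Unset Strict Implicit.
Unset Printing Implicit Defensive.

Import Order.TTheory GRing.Theory Num.Theory.
Import numFieldNormedType.Exports.

Local Open Scope classical_set_scope.
Local Open Scope ring_scope.

(* The complex numbers over R. The alias is typed as a numClosedFieldType so
   that the topology and the norm attached by MathComp-Analysis to any
   numFieldType are inferred on it (they are not on the bare type R[i], which
   is also an lmodType over R). *)
Definition Cplx (R : realType) : numClosedFieldType := R[i]%C.

Record hilbertSpace (K : numClosedFieldType) := HilbertSpace {
  hilbert_sort :> completeNormedModType K ;
  hdot : {dot hilbert_sort for Num.conj} ;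
  hdotE : forall x, hdot x x = `|x| ^+ 2
}.
Arguments hdot {K h}.

Section Operators.
Variables (K : numClosedFieldType) (H : hilbertSpace K).
Implicit Types (A : set (H -> H)) (T : H -> H).

Definition bounded_op T := linear T /\ exists M : K, forall x, `|T x| <= M * `|x|.

(* Adjoints and inverses are unique when they exist; 0 is the default value. *)
Definition adjoint T : H -> H :=
  xget 0 [set T' | forall x y, hdot (T x) y = hdot x (T' y)].

Definition inverse_op T : H -> H :=
  xget 0 [set T' | bounded_op T' /\ T' \o T = idfun /\ T \o T' = idfun].

Definition positive_op T := forall x, 0 <= hdot (T x) x.

(* closure in B(H) for the operator norm: || T - U || <= e *)
Definition norm_closure A : set (H -> H) :=
  [set T | bounded_op T /\ forall e : K, 0 < e ->
    exists2 U, A U & forall x, `|T x - U x| <= e * `|x|].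

Definition adjoint_set A : set (H -> H) := [set adjoint T | T in A].

Definition sum_set A B : set (H -> H) := [set T + U | T in A & U in B].

(* A functional on a subspace A of B(H) is a function on all of H -> H whose
   values off A are irrelevant. *)
Definition positive_functional A (mu : (H -> H) -> K) :=
  (forall a T U, A T -> A U -> mu (a *: T + U) = a * mu T + mu U) /\
  (forall T, A T -> positive_op T -> 0 <= mu T).

End Operators.

Definition unitary (K : numClosedFieldType) (H1 H2 : hilbertSpace K)
    (U : {linear H1 -> H2}) :=
  (forall x y, hdot (U x) (U y) = hdot x y) /\ (forall y, exists x, U x = y).

(* The reproducing kernel Hilbert space with kernel k: a Hilbert space of
   functions on X (rkhs_fun identifies its elements with functions) containing
   every k(., w), with the reproducing property; k determines it uniquely. *)
Record rkhs (R : realType) (X : Type) (k : X -> X -> Cplx R) := Rkhs {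
  rkhs_sort :> hilbertSpace (Cplx R) ;
  rkhs_fun : {linear rkhs_sort -> (X -> Cplx R)} ;
  rkhs_fun_inj : injective rkhs_fun ;
  rkhs_reproducing : forall w, exists2 kw : rkhs_sort,
    rkhs_fun kw = k^~ w & forall f, rkhs_fun f w = hdot f kw
}.
Arguments rkhs_fun {R X k} r.

Section ComplexLimits.
Variable R : realType.
Local Notation C := (Cplx R).

Lemma ReB (x y : C) : complex.Re (x - y) = complex.Re x - complex.Re y.
Proof. by case: x; case: y. Qed.
Lemma ImB (x y : C) : complex.Im (x - y) = complex.Im x - complex.Im y.
Proof. by case: x; case: y. Qed.

Lemma normRe_le (x : C) : (`|complex.Re x|)%:C%C <= `|x| :> C.
Proof. exact: normc_ge_Re. Qed.

Lemma normIm_le (x : C) : (`|complex.Im x|)%:C%C <= `|x| :> C.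
Proof.
have := normRe_le ('i%C * x : C); rewrite normrM.
have -> : `|('i%C : C)| = 1 by rewrite normc_def /= expr0n expr1n add0r sqrtr1.
by rewrite mul1r; case: x => a b /=; rewrite mul0r mul1r add0r normrN.
Qed.

Lemma norm_le_ReIm (x : C) :
  `|x| <= (`|complex.Re x| + `|complex.Im x|)%:C%C :> C.
Proof.
case: x => a b; rewrite normc_def lecR /=.
rewrite -[leRHS]ger0_norm ?addr_ge0// -sqrtr_sqr ler_sqrt ?sqr_ge0//.
rewrite sqrrD !real_normK ?num_real// -addrA lerD2l.
by rewrite lerDr mulrn_wge0// mulr_ge0.
Qed.

Lemma Cplx_complete (F : set_system C) : ProperFilter F -> cauchy F -> cvg F.
Proof.
move=> FF Fc.
have H (f : C -> R) : (forall x y : C, f (x - y) = f x - f y) ->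
    (forall x : C, (`|f x|)%:C%C <= `|x| :> C) -> cvg (f @ F).
  move=> fB fle; apply: R_complete.
  apply/cauchy_ballP => e e0; move/cauchy_ballP : Fc => /(_ (e%:C%C : C)).
  rewrite ltcR => /(_ e0) [[/= A B] /= [FA FB] sAB].
  exists (f @` A, f @` B) => /=.
    by split => /=; [apply: filterS FA|apply: filterS FB] => x Ax; exists x.
  move=> [_ _] /= [[x Ax <-] [y By <-]].
  have := sAB (x, y) (conj Ax By).
  rewrite /= -!ball_normE /= => xy.
  by rewrite -fB -ltcR; exact: le_lt_trans (fle _) xy.
have /cvg_ex[a Fa] := H _ ReB normRe_le.
have /cvg_ex[b Fb] := H _ ImB normIm_le.
apply/cvg_ex; exists (Complex a b : C).
apply/cvgrPdist_lt => -[e ei]; rewrite ltcE /= => /andP[/eqP ei0 e0]; subst ei.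
have e20 : 0 < e / 2 by rewrite divr_gt0.
move/cvgrPdist_lt : Fa => /(_ _ e20) Fa.
move/cvgrPdist_lt : Fb => /(_ _ e20) Fb.
apply: filterS2 Fa Fb => x xa xb.
apply: le_lt_trans (norm_le_ReIm _) _.
by rewrite ltcR ReB ImB /= [ltRHS]splitr ltrD.
Qed.

Lemma cvg_Re (T : Type) (F : set_system T) {FF : Filter F} (u : T -> C) (l : C) :
  u @ F --> l -> (fun t => complex.Re (u t)) @ F --> complex.Re l.
Proof.
move/cvgrPdist_lt => h; apply/cvgrPdist_lt => e e0.
have := h (e%:C%C); rewrite ltcR => /(_ e0); apply: filterS => t /= ht.
by rewrite -ReB -ltcR; exact: le_lt_trans (normRe_le _) ht.
Qed.

Lemma cvg_Im (T : Type) (F : set_system T) {FF : Filter F} (u : T -> C) (l : C) :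
  u @ F --> l -> (fun t => complex.Im (u t)) @ F --> complex.Im l.
Proof.
move/cvgrPdist_lt => h; apply/cvgrPdist_lt => e e0.
have := h (e%:C%C); rewrite ltcR => /(_ e0); apply: filterS => t /= ht.
by rewrite -ImB -ltcR; exact: le_lt_trans (normIm_le _) ht.
Qed.

Lemma cvg_conjC (T : Type) (F : set_system T) {FF : Filter F} (u : T -> C) (l : C) :
  u @ F --> l -> (fun t => (u t)^*) @ F --> l^*.
Proof.
move/cvgrPdist_lt => h; apply/cvgrPdist_lt => e e0.
apply: filterS (h _ e0) => t; by rewrite -rmorphB norm_conjC.
Qed.

Lemma C_le_lim (T : Type) (F : set_system T) (FF : ProperFilter F)
    (u : T -> C) (l M : C) :
  u @ F --> l -> (\forall t \near F, u t <= M) -> l <= M.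
Proof.
move=> ul uM; rewrite lecE; apply/andP; split.
  apply/eqP; have : (fun t => complex.Im (u t)) @ F --> complex.Im M.
    apply: cvg_near_cst; apply: filterS uM => t /=.
    by rewrite lecE => /andP[/eqP].
  move=> /(cvg_lim (@Rhausdorff R)) <-.
  by apply: (cvg_lim (@Rhausdorff R)); exact: cvg_Im.
have uRe : complex.Re (u t) @[t --> F] --> complex.Re l by exact: cvg_Re.
rewrite -(cvg_lim (@Rhausdorff R) uRe); apply: limr_le; first exact: cvgP uRe.
by apply: filterS uM => t /=; rewrite lecE => /andP[].
Qed.

Lemma C_ge_lim (T : Type) (F : set_system T) (FF : ProperFilter F)
    (u : T -> C) (l M : C) :
  u @ F --> l -> (\forall t \near F, M <= u t) -> M <= l.
Proof.
move=> /cvgN ul uM; rewrite -lerN2; apply: C_le_lim ul _.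
by apply: filterS uM => t /=; rewrite lerN2.
Qed.

End ComplexLimits.

Section CauchySchwarz.
Variables (K : numClosedFieldType) (U : lmodType K) (form : {dot U for Num.conj}).

Lemma dot_ge0 u : 0 <= form u u.
Proof.
have [->|/neq0_dnorm_gt0/ltW//] := eqVneq u 0.
by rewrite linear0l.
Qed.

Lemma dotC u v : form u v = (form v u)^*.
Proof. by rewrite hermC expr0 mul1r. Qed.

Lemma dot_CauchySchwarz u v : `|form u v| ^+ 2 <= form u u * form v v.
Proof.
have [->|v0] := eqVneq v 0.
  by rewrite linear0l linear0r normr0 expr0n mulr0.
have vv0 : 0 < form v v by exact: neq0_dnorm_gt0.
pose w := form v v *: u - form u v *: v.
have := dot_ge0 w.
have vvE : (form v v)^* = form v v by rewrite -dotC.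
have -> : form w w = form v v * (form u u * form v v - `|form u v| ^+ 2).
  rewrite normCK -dotC /w; set rhs := RHS; rewrite linearBl !linearBr !linearZl_LR !linearZr_LR /= vvE.
  by rewrite -dotC /GRing.scale /= /rhs; ring.
by rewrite pmulr_rge0// subr_ge0.
Qed.

Lemma dot_triangle u v :
  sqrtC (form (u + v) (u + v)) <= sqrtC (form u u) + sqrtC (form v v).
Proof.
rewrite -(@ler_pXn2r _ 2%N)// ?nnegrE ?addr_ge0 ?sqrtC_ge0 ?dot_ge0//.
rewrite sqrrD !sqrtCK hnormD /= expr0 mul1r addrAC lerD2r lerD2l.
have le1 : `|form u v| <= sqrtC (form u u) * sqrtC (form v v).
  rewrite -(@ler_pXn2r _ 2%N)// ?nnegrE ?mulr_ge0 ?sqrtC_ge0 ?dot_ge0//.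
  by rewrite exprMn !sqrtCK dot_CauchySchwarz.
apply: le_trans (_ : `|form u v| *+ 2 <= _); last by rewrite lerMn2r le1 orbT.
set d := form u v; have dd : d + d^* = 'Re d *+ 2.
  by rewrite ReE mulr2n -splitr.
rewrite dd lerMn2r /=; apply: le_trans _ (leif_normC_Re_Creal d).1.
by apply: real_ler_norm; exact: Creal_Re.
Qed.
End CauchySchwarz.

Section WordSums.
Variables (R : realType) (d : nat).
Local Notation C := (Cplx R).
Local Notation word := (seq 'I_d).

(* The partial sums, over the words of length < N, of a family indexed by words *)
Definition psum (a : word -> C) (N : nat) : C :=
  \sum_(n < N) \sum_(t : n.-tuple 'I_d) a t.

Lemma psum_ext a b N : (forall w, a w = b w) -> psum a N = psum b N.
Proof. by move=> ab; do 2 apply: eq_bigr => ? _. Qed.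

Lemma psumD a b N : psum (fun w => a w + b w) N = psum a N + psum b N.
Proof. by rewrite /psum -big_split; apply: eq_bigr => n _; exact: big_split. Qed.

Lemma psumZ c a N : psum (fun w => c * a w) N = c * psum a N.
Proof. by rewrite /psum mulr_sumr; apply: eq_bigr => n _; rewrite mulr_sumr. Qed.

Lemma psum_conj a N : psum (fun w => (a w)^*) N = (psum a N)^*.
Proof. by rewrite rmorph_sum; apply: eq_bigr => n _; rewrite rmorph_sum. Qed.

Lemma psum_le a b N : (forall w, a w <= b w) -> psum a N <= psum b N.
Proof. by move=> ab; do 2 apply: ler_sum => ? _. Qed.

Lemma psum_ge0 a N : (forall w, 0 <= a w) -> 0 <= psum a N.
Proof. by move=> a0; do 2 apply: sumr_ge0 => ? _. Qed.

Lemma psum_homo a m n : (forall w, 0 <= a w) -> (m <= n)%N ->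
  psum a m <= psum a n.
Proof.
move=> a0 /subnK <-; elim: (n - m)%N => // k ih; apply: le_trans ih _.
by rewrite addSn /psum big_ord_recr /= lerDl sumr_ge0.
Qed.

Lemma le_psum a (w : word) : (forall w, 0 <= a w) ->
  a w <= psum a (size w).+1.
Proof.
move=> a0; rewrite /psum big_ord_recr /= -[leLHS]add0r lerD//.
  by do 2 apply: sumr_ge0 => ? _.
by rewrite (bigD1 (in_tuple w)) //= lerDl sumr_ge0.
Qed.

Lemma psum_dist a b m n : (forall w, `|a w| <= b w) ->
  `|psum a m - psum a n| <= `|psum b m - psum b n|.
Proof.
move=> ab.
have b0 w : 0 <= b w := le_trans (normr_ge0 _) (ab w).
wlog mn : m n / (n <= m)%N.
  move=> H; have [/H//|/ltnW/H] := leqP n m.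
  by rewrite distrC [leRHS]distrC.
rewrite [leRHS]ger0_norm ?subr_ge0 ?psum_homo//.
elim: m mn => [|m ih]; first by rewrite leqn0 => /eqP ->; rewrite !subrr normr0.
rewrite leq_eqVlt ltnS => /predU1P[->|/ih {}ih]; first by rewrite !subrr normr0.
rewrite /psum !big_ord_recr /= -!/(psum _ _) addrAC [leRHS]addrAC.
apply: le_trans (ler_normD _ _) _; rewrite lerD//.
by apply: le_trans (ler_norm_sum _ _ _) _; exact: ler_sum.
Qed.

Lemma cvg_psum a b M : (forall w, `|a w| <= b w) ->
  (forall N, psum b N <= M) -> cvgn (psum a).
Proof.
move=> ab bM.
have b0 w : 0 <= b w := le_trans (normr_ge0 _) (ab w).
pose r N := complex.Re (psum b N).
have rE N : psum b N = (r N)%:C%C.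
  have := psum_ge0 N b0; rewrite /r; case: (psum b N) => x y.
  by rewrite lecE /= => /andP[/eqP -> _].
have : cvgn r.
  apply: nondecreasing_is_cvgn.
    by move=> m n mn; rewrite -lecR -!rE psum_homo.
  exists (complex.Re M) => _ [N _ <-].
  by have := bM N; rewrite lecE => /andP[].
move=> /cvg_ex[l /cvgrPdist_lt rl].
apply: Cplx_complete; apply/cauchy_ballP => -[e ei].
rewrite ltcE /= => /andP[/eqP ei0 e0]; subst ei.
have e20 : 0 < e / 2 by rewrite divr_gt0.
have {}rl := rl _ e20.
exists (psum a @` [set n | `|l - r n| < e / 2],
        psum a @` [set n | `|l - r n| < e / 2]).
  by split => /=; apply: filterS rl => n ?; exists n.
move=> [_ _] [/= [m lm <-] [n ln <-]] /=; rewrite -ball_normE /=.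
apply: le_lt_trans (psum_dist _ _ ab) _.
rewrite !rE -rmorphB /= normc_def /= expr0n addr0 sqrtr_sqr ltcR.
rewrite (_ : r m - r n = (l - r n) - (l - r m)); last by ring.
by apply: le_lt_trans (ler_normB _ _) _; rewrite [ltRHS]splitr ltrD.
Qed.

End WordSums.

Section L2.
Variables (R : realType) (d : nat).
Local Notation C := (Cplx R).
Local Notation word := (seq 'I_d).

Definition square_summable : {pred word -> C} := fun f =>
  `[< exists M : C, forall N, psum (fun w => `|f w| ^+ 2) N <= M >].

Lemma sqnormD (x y : C) : `|x + y| ^+ 2 <= `|x| ^+ 2 *+ 2 + `|y| ^+ 2 *+ 2.
Proof.
rewrite -subr_ge0 (_ : _ - _ = `|x - y| ^+ 2) ?exprn_ge0//.
by rewrite !normCK rmorphB rmorphD /=; ring.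
Qed.

Lemma square_summable_submod : submod_closed square_summable.
Proof.
split.
  apply/asboolP; exists 0 => N; rewrite /psum big1// => n _.
  by rewrite big1// => t _; rewrite normr0 expr0n.
move=> a f g /asboolP[M fM] /asboolP[M' gM']; apply/asboolP.
exists (`|a| ^+ 2 *+ 2 * M + 2 * M') => N.
apply: (@le_trans _ _ (psum (fun w =>
    `|a| ^+ 2 *+ 2 * `|f w| ^+ 2 + 2 * `|g w| ^+ 2) N)).
  apply: psum_le => w; apply: le_trans (sqnormD _ _) _.
  by rewrite normrM exprMn mulrnAl mulr_natl.
by rewrite psumD !psumZ lerD// ler_wpM2l// mulrn_wge0// exprn_ge0.
Qed.

HB.instance Definition _ := GRing.isSubmodClosed.Build C (word -> C)
  square_summable square_summable_submod.

Record l2 := L2 { l2_fun :> word -> C ; _ : l2_fun \in square_summable }.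

HB.instance Definition _ := [isSub for l2_fun].
HB.instance Definition _ := [Choice of l2 by <:].
HB.instance Definition _ := [SubChoice_isSubLmodule of l2 by <:].

(* limit of the partial sums; the series converges absolutely (l2_dot_cvg) *)
Definition l2_dot (f g : l2) : C := limn (psum (fun w => f w * (g w)^*)).

Lemma l2P (f : l2) : exists M : C, forall N, psum (fun w => `|f w| ^+ 2) N <= M.
Proof. by case: f => f /= /asboolP. Qed.

Lemma l2_ext (f g : l2) : (forall w, f w = g w) -> f = g.
Proof. by move=> fg; apply: val_inj; apply/funext. Qed.

Lemma l2_dot_cvg (f g : l2) :
  psum (fun w => f w * (g w)^*) @ \oo --> l2_dot f g.
Proof.
have [M fM] := l2P f; have [M' gM'] := l2P g.
apply: (@cvg_psum _ _ _ (fun w => `|f w| ^+ 2 + `|g w| ^+ 2) (M + M')).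
  move=> w; rewrite normrM norm_conjC.
  have h : 0 <= (`|f w| - `|g w|) ^+ 2.
    by rewrite real_exprn_even_ge0// rpredB// normr_real.
  have : `|f w| * `|g w| *+ 2 <= `|f w| ^+ 2 + `|g w| ^+ 2.
    by move: h; rewrite sqrrB addrAC subr_ge0.
  apply: le_trans; rewrite mulr2n lerDl mulr_ge0//.
by move=> N; rewrite psumD lerD.
Qed.

Arguments l2_dot_cvg : clear implicits.

Lemma limC_unique (u : nat -> C) (a b : C) : u @ \oo --> a -> u @ \oo --> b -> a = b.
Proof. by move=> ua ub; apply: (cvg_unique _ ua ub); exact: norm_hausdorff. Qed.

Lemma l2_dot_herm (f g : l2) : l2_dot f g = (-1) ^+ false * (l2_dot g f)^*.
Proof.
rewrite expr0 mul1r; apply: limC_unique (l2_dot_cvg f g) _.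
rewrite (_ : psum _ = fun N => (psum (fun w => g w * (f w)^*) N)^*).
  by apply: cvg_conjC; exact: l2_dot_cvg.
apply/funext => N; rewrite -psum_conj; apply: psum_ext => w.
by rewrite rmorphM /= conjCK mulrC.
Qed.

Lemma l2_dot_linearl (g : l2) : GRing.linear_for *%R (l2_dot^~ g).
Proof.
move=> a f h /=; apply: limC_unique (l2_dot_cvg _ g) _.
rewrite (_ : psum _ = fun N => a * psum (fun w => f w * (g w)^*) N
   + psum (fun w => h w * (g w)^*) N).
  apply: cvgD; last exact: l2_dot_cvg.
  by apply: cvgMr; exact: l2_dot_cvg.
apply/funext => N; rewrite -psumZ -psumD; apply: psum_ext => w.
by rewrite mulrA -mulrDl.
Qed.

Lemma l2_dot_bilinear : bilinear_for *%R (Num.conj \; *%R : GRing.Scale.law C C) l2_dot.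
Proof.
split=> [g|f]; first exact: l2_dot_linearl.
move=> a g h /=; rewrite l2_dot_herm expr0 mul1r l2_dot_linearl rmorphD rmorphM /=.
by rewrite (l2_dot_herm f g) (l2_dot_herm f h) expr0 !mul1r.
Qed.

HB.instance Definition _ := bilinear_isBilinear.Build C l2 l2 C *%R
  (Num.conj \; *%R) l2_dot l2_dot_bilinear.
HB.instance Definition _ := isHermitianSesquilinear.Build C l2 false Num.conj
  l2_dot l2_dot_herm.

Lemma psum_le_dot (f : l2) N : psum (fun w => `|f w| ^+ 2) N <= l2_dot f f.
Proof.
apply: C_ge_lim (l2_dot_cvg f f) _.
exists N => // n /= Nn; rewrite [leRHS](@psum_ext _ _ _ (fun w => `|f w| ^+ 2)).
  by apply: psum_homo => // w; rewrite exprn_ge0.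
by move=> w; rewrite normCK.
Qed.

Lemma dot_le_psum (f : l2) (M : C) :
  (forall N, psum (fun w => `|f w| ^+ 2) N <= M) -> l2_dot f f <= M.
Proof.
move=> fM; apply: C_le_lim (l2_dot_cvg f f) _; apply: nearW => n.
rewrite (@psum_ext _ _ _ (fun w => `|f w| ^+ 2))// => w; by rewrite normCK.
Qed.

Lemma sqnorm_le_dot (f : l2) w : `|f w| ^+ 2 <= l2_dot f f.
Proof.
apply: le_trans (psum_le_dot f (size w).+1).
by apply: (le_psum (a := fun w => `|f w| ^+ 2)) => v; rewrite exprn_ge0.
Qed.

Lemma l2_dot_gt0 (f : l2) : f != 0 -> 0 < l2_dot f f.
Proof.
move=> f0; have ge0 : 0 <= l2_dot f f.
  by apply: le_trans (sqnorm_le_dot f [::]); rewrite exprn_ge0.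
rewrite lt_neqAle ge0 andbT eq_sym; apply: contra f0 => /eqP ff0.
apply/eqP; apply: l2_ext => w; apply/eqP.
have := sqnorm_le_dot f w; rewrite ff0 -normr_eq0 -sqrf_eq0 => h.
by rewrite eq_le h exprn_ge0.
Qed.

HB.instance Definition _ := isDotProduct.Build C l2 l2_dot l2_dot_gt0.

Definition l2_norm (f : l2) : C := sqrtC (l2_dot f f).

Lemma l2_norm_triangle f g : l2_norm (f + g) <= l2_norm f + l2_norm g.
Proof. exact: (dot_triangle (l2_dot : {dot l2 for Num.conj})). Qed.

Lemma l2_normZ a f : l2_norm (a *: f) = `|a| * l2_norm f.
Proof.
rewrite /l2_norm linearZl_LR linearZr_LR /= /GRing.scale /= mulrA -normCK.
by rewrite rootCMl ?exprn_ge0// sqrCK.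
Qed.

Lemma l2_norm0_eq0 f : l2_norm f = 0 -> f = 0.
Proof.
move/eqP; rewrite sqrtC_eq0 => /eqP f0; apply/eqP/negPn/negP => /l2_dot_gt0.
by rewrite f0 ltxx.
Qed.

HB.instance Definition _ := Lmodule_isNormed.Build C l2
  l2_norm_triangle l2_normZ l2_norm0_eq0.

Lemma l2_dotE (f : l2) : l2_dot f f = `|f| ^+ 2.
Proof. by rewrite [in RHS]/Num.norm /= sqrtCK. Qed.

Lemma l2_coord_le (f : l2) w : `|f w| <= `|f|.
Proof.
by rewrite -(@ler_pXn2r _ 2%N)// ?nnegrE// -l2_dotE; exact: sqnorm_le_dot.
Qed.

Lemma l2_complete (F : set_system l2) : ProperFilter F -> cauchy F -> cvg F.
Proof.
move=> FF /cauchy_ballP Fc.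
have /choice[l fl] : forall w, exists c : C, (fun f : l2 => f w) @ F --> c.
  move=> w; apply/cvg_ex; apply: Cplx_complete.
  apply/cauchy_ballP => e /Fc[[/= A B] /= [FA FB] sAB].
  exists ((fun f : l2 => f w) @` A, (fun f : l2 => f w) @` B) => /=.
    by split => /=; [apply: filterS FA|apply: filterS FB] => x Ax; exists x.
  move=> [_ _] /= [[x Ax <-] [y By <-]].
  have := sAB (x, y) (conj Ax By); rewrite /= -!ball_normE /=.
  by apply: le_lt_trans; exact: (l2_coord_le (x - y)).
have Fsmall (e : C) : 0 < e -> exists2 A, F A & forall f : l2, A f ->
    forall N, psum (fun w => `|f w - l w| ^+ 2) N <= e ^+ 2.
  move=> e0; have [[/= A B] /= [FA FB] sAB] := Fc _ e0.
  exists A => // f Af N.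
  have : (fun g : l2 => psum (fun w => `|f w - g w| ^+ 2) N) @ F
      --> psum (fun w => `|f w - l w| ^+ 2) N.
    rewrite /psum; apply: cvg_big => [|n _]; first exact: add_continuous.
    apply: cvg_big => [|t _]; first exact: add_continuous.
    have h : (fun g : l2 => `|f t - g t|) @ F --> `|f t - l t|.
      by apply: cvg_norm; apply: cvgB; [exact: cvg_cst|exact: fl].
    by rewrite expr2; apply: cvgM.
  move/C_le_lim; apply; apply: filterS FB => g Bg.
  have := sAB (f, g) (conj Af Bg); rewrite /= -ball_normE /= => /ltW fg.
  apply: le_trans (psum_le_dot (f - g) N) _.
  by rewrite l2_dotE lerXn2r// nnegrE// ltW.
have [A1 FA1 A1P] := Fsmall 1 ltr01.
have [f0 A1f0] := filter_ex FA1.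
have lE (f : l2) : (exists M : C, forall N,
    psum (fun w => `|f w - l w| ^+ 2) N <= M) -> (fun w => f w - l w) \in square_summable.
  by move=> h; apply/asboolP.
have f0l := lE _ (ex_intro _ _ (A1P _ A1f0)).
pose L : l2 := f0 - L2 f0l.
have LE w : L w = l w by rewrite /= opprB addrC subrK.
have near_L (e : C) (f : l2) : 0 < e ->
    (forall N, psum (fun w => `|f w - l w| ^+ 2) N <= e ^+ 2) -> `|L - f| <= e.
  move=> e0 fA; rewrite distrC -(@ler_pXn2r _ 2%N)// ?nnegrE ?(ltW e0)//.
  rewrite -l2_dotE; apply: dot_le_psum => N; apply: le_trans (fA N).
  by rewrite (@psum_ext _ _ _ (fun w => `|f w - l w| ^+ 2))// => w; rewrite -LE.
apply/cvg_ex; exists L; apply/cvgrPdist_le => e e0.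
have [A FA AP] := Fsmall _ e0.
by apply: filterS FA => f /AP; exact: near_L.
Qed.

HB.instance Definition _ := Uniform_isComplete.Build l2 l2_complete.

(* l^2 of the free semigroup on d letters, words being seq 'I_d *)
Definition ell2 : hilbertSpace C := @HilbertSpace C l2 l2_dot l2_dotE.

End L2.

Section FreeSemigroupAlgebra.
Variables (R : realType) (d : nat).
Local Notation C := (Cplx R).
Local Notation word := (seq 'I_d).
Local Notation F2 := (ell2 R d).

Lemma psumS (a : word -> C) N :
  psum a N.+1 = a [::] + \sum_(i < d) psum (fun w => a (i :: w)) N.
Proof.
rewrite /psum big_ord_recl; congr (_ + _).
  by rewrite (big_pred1 [tuple]) => // t; apply/esym/eqP; exact: tuple0.
rewrite exchange_big /=; apply: eq_bigr => n _.
rewrite pair_big /=.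
rewrite (reindex (fun p : 'I_d * n.-tuple 'I_d => [tuple of p.1 :: p.2])) //=.
exists (fun t : n.+1.-tuple 'I_d => (thead t, [tuple of behead t])) => [[i t] _|t _] /=.
  by congr (_, _); apply: val_inj.
by rewrite [RHS]tuple_eta; apply: val_inj.
Qed.

Definition shift_fun (i : 'I_d) (f : word -> C) (w : word) : C :=
  if w is j :: v then if j == i then f v else 0 else 0.

Lemma shift_fun_l2 i (f : l2 R d) : shift_fun i f \in @square_summable R d.
Proof.
have [M fM] := l2P f; apply/asboolP; exists M => -[|N].
  by rewrite /psum big_ord0; have := fM 0; rewrite /psum big_ord0.
rewrite psumS /= normr0 expr0n add0r (bigD1 i) //= [X in _ + X]big1 => [|j ji].
  by rewrite addr0 eqxx.
rewrite (negbTE ji) /psum big1// => n _; rewrite big1// => t _.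
by rewrite normr0 expr0n.
Qed.

(* the left creation operator L_i, see shift_xi *)
Definition shift (i : 'I_d) : F2 -> F2 := fun f => L2 (shift_fun_l2 i f).

Definition xi_fun (v w : word) : C := (w == v)%:R.

Lemma xi_fun_l2 v : xi_fun v \in @square_summable R d.
Proof.
set b := fun w => `|xi_fun v w| ^+ 2.
apply/asboolP; exists (psum b (size v).+1) => N.
have b0 w : 0 <= b w by rewrite exprn_ge0.
have [/psum_homo -> //|] := leqP N (size v).+1.
elim: N => // N ih; rewrite ltnS => vN.
have le_N : psum b N <= psum b (size v).+1.
  by move: vN; rewrite leq_eqVlt => /predU1P[<-//|/ih].
apply: le_trans le_N; rewrite /psum big_ord_recr /= [X in _ + X]big1 ?addr0//.
move=> t _; rewrite /b /xi_fun; have [tv|_] := eqVneq (tval t) v.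
  by move: vN; rewrite -tv size_tuple ltnn.
by rewrite normr0 expr0n.
Qed.

Definition xi (v : word) : F2 := L2 (xi_fun_l2 v).

Lemma shift_xi i v : shift i (xi v) = xi (i :: v).
Proof.
apply: l2_ext => -[|j w] //=; rewrite /xi_fun eqseq_cons.
by case: eqP.
Qed.

Definition word_op (w : word) : F2 -> F2 :=
  foldr (fun i T => shift i \o T) idfun w.

(* L^(n): the sum over the words with exactly n i occurrences of each letter i;
   such words have length \sum_i n i *)
Definition sym_op (n : 'I_d -> nat) : F2 -> F2 :=
  \sum_(w : (\sum_i n i)%N.-tuple 'I_d | [forall i, count_mem i w == n i])
    word_op w.

Definition nc_poly : set (F2 -> F2) :=
  [set p | exists s : seq (C * ('I_d -> nat)),
     p = \sum_(a <- s) a.1 *: sym_op a.2].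

(* S *)
Definition sym_space : set (F2 -> F2) := norm_closure nc_poly.

(* S + S* *)
Definition op_system : set (F2 -> F2) :=
  sum_set sym_space (adjoint_set sym_space).

Definition state (mu : (F2 -> F2) -> C) := positive_functional op_system mu.

(* mubar is the (unique) positive extension of mu to the norm closure of S + S*,
   the domain that contains the products adjoint q \o p and resolvent z \o p *)
Definition state_extension (mu mubar : (F2 -> F2) -> C) :=
  positive_functional (norm_closure op_system) mubar /\
  forall T, op_system T -> mubar T = mu T.

(* P^2(mu), as the completion of the image of S *)
Record P2_space (mubar : (F2 -> F2) -> C) := P2Space {
  P2_sort :> hilbertSpace C ;
  P2_class : (F2 -> F2) -> P2_sort ;
  P2_class_linear : forall a p q, sym_space p -> sym_space q ->
    P2_class (a *: p + q) = a *: P2_class p + P2_class q ;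
  P2_class_dot : forall p q, sym_space p -> sym_space q ->
    hdot (P2_class p) (P2_class q) = mubar (adjoint q \o p) ;
  P2_class_dense : closure (P2_class @` sym_space) = setT
}.

Definition unit_ball := {z : 'rV[C]_d | \sum_j `|z 0 j| ^+ 2 < 1}.

Lemma unit_ball0_subproof : \sum_j `|(0 : 'rV[C]_d) 0 j| ^+ 2 < 1.
Proof. by rewrite big1 // => j _; rewrite mxE normr0 expr0n. Qed.

Definition unit_ball0 : unit_ball := exist _ 0 unit_ball0_subproof.

(* z w* *)
Definition herm (z w : unit_ball) : C := \sum_j val z 0 j * (val w 0 j)^*.

Definition drury_arveson_kernel (z w : unit_ball) : C := (1 - herm z w)^-1.

(* the kernel k^b of H(b), the de Branges-Rovnyak space *)
Definition dbr_kernel (b : unit_ball -> C) (z w : unit_ball) : C :=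
  (1 - b z * (b w)^*) / (1 - herm z w).

(* The ball is open, so differentiability at its points does not depend on the
   extension by 0. *)
Definition holomorphic (f : unit_ball -> C) :=
  forall z : unit_ball,
    differentiable (fun x : 'rV[C]_d => oapp f 0 (insub x)) (val z).

Definition contractive_multiplier (H2 : rkhs drury_arveson_kernel)
    (b : unit_ball -> C) :=
  holomorphic b /\
  forall f : H2, exists2 g : H2,
    rkhs_fun H2 g = (fun z => b z * rkhs_fun H2 f z) & `|g| <= `|f|.

Definition zLadj (z : unit_ball) : F2 -> F2 :=
  \sum_j val z 0 j *: adjoint (shift j).

Definition resolvent (z : unit_ball) : F2 -> F2 :=
  inverse_op (idfun - zLadj z).

Definition represents (mu : (F2 -> F2) -> C) (b : unit_ball -> C) :=
  forall z, (1 + b z) / (1 - b z) =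
    mu ((idfun + zLadj z) \o resolvent z) +
    'i * 'Im ((1 + b unit_ball0) / (1 - b unit_ball0)).

Definition fantappie (mubar : (F2 -> F2) -> C) (b : unit_ball -> C)
    (p : F2 -> F2) (z : unit_ball) : C :=
  (1 - b z) * mubar (resolvent z \o p).

End FreeSemigroupAlgebra.

(* Main.v *)
From HB Require Import structures.
Require Import Defs.
From mathcomp Require Import all_boot all_order all_algebra.
From mathcomp Require Import all_classical all_reals all_analysis.
From mathcomp Require Import complex sesquilinear ring.
Set Implicit Arguments.
Unset Strict Implicit.
Unset Printing Implicit Defensive.

Import Order.TTheory GRing.Theory Num.Theory.
Import numFieldNormedType.Exports.
Local Open Scope classical_set_scope.
Local Open Scope ring_scope.

(** Put [K_z = (I - \sum_j z_j^* L_j)^-1] for [z] in the ball ([szego z] below).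
    It is a norm limit of polynomials and the adjoint of the resolvent
    [(I - z L^* )^-1], so that
    [mubar ((I - z L^* )^-1 p) = <[p], [K_z]>] in [P2]: the transform evaluates
    [[p]] against the vectors [[K_z]], up to the factor [1 - b z].

    Since [L_i^* L_j = \delta_ij], one has [(z L^* ) (w L^* )^* = (z w^* ) I], and
    therefore
      [(1 - z w^* ) (I - z L^* )^-1 K_w = (I - z L^* )^-1 + K_w - I]
    ([resolvent_szego]).  Applying the state and its Herglotz representation of
    [b] gives
      [<[K_w], [K_z]> = k^b(z, w) / ((1 - b z) (1 - b w)^* )]
    ([gram_szego]), which is also the Gram matrix of the vectors
    [k^b_z / (1 - b z)^*] of [H(b)].  The denominators do not vanish: if
    [b z0 = 1], then the adjoint of multiplication by [b] fixes the
    Drury-Arveson kernel at [z0]; a contraction and its adjoint have the same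
    fixed vectors, whence [b = 1] everywhere
    ([contractive_multiplier_neq1]).

    Two total families with the same Gram matrix are exchanged by a unitary
    ([unitary_of_gram]).  The kernels of [H(b)] are total by the reproducing
    property.  The [[K_z]] are total in [P2] ([szego_total]): a vector
    orthogonal to all the [[K_(t z)]] is orthogonal to the Taylor
    coefficients in [t], which are the powers [(\sum_j z_j^* L_j)^m]
    ([orth_power]); these powers span the polynomials ([sym_op_span]); and
    [[p]] depends continuously on [p] because [p^* p] lies in the closure of
    [S + S^*] ([norm_closure_gram], [functional_gram_bound]). *)

(** * Inner products *)

Section HilbertSpace.
Context {R : realType} {H : hilbertSpace (Cplx R)}.
Local Notation C := (Cplx R).
Implicit Types x y : H.

Lemma hdotDl x y w : hdot (x + y) w = hdot x w + hdot y w.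
Proof. exact: linearDl. Qed.
Lemma hdotDr x y w : hdot w (x + y) = hdot w x + hdot w y.
Proof. exact: linearDr. Qed.
Lemma hdotBl x y w : hdot (x - y) w = hdot x w - hdot y w.
Proof. exact: linearBl. Qed.
Lemma hdotBr x y w : hdot w (x - y) = hdot w x - hdot w y.
Proof. exact: linearBr. Qed.
Lemma hdotZl (a : C) x w : hdot (a *: x) w = a * hdot x w.
Proof. by rewrite linearZl_LR. Qed.
Lemma hdotZr (a : C) x w : hdot w (a *: x) = a^* * hdot w x.
Proof. by rewrite linearZr_LR. Qed.
Lemma hdot0l w : hdot (0 : H) w = 0.
Proof. exact: linear0l. Qed.
Lemma hdot0r w : hdot w (0 : H) = 0.
Proof. exact: linear0r. Qed.
Lemma hdot_suml I (r : seq I) (P : pred I) (F : I -> H) w :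
  hdot (\sum_(i <- r | P i) F i) w = \sum_(i <- r | P i) hdot (F i) w.
Proof. by elim/big_rec2: _ => [|i y1 y2 _ <-]; rewrite ?hdot0l ?hdotDl. Qed.
Lemma hdot_sumr I (r : seq I) (P : pred I) (F : I -> H) w :
  hdot w (\sum_(i <- r | P i) F i) = \sum_(i <- r | P i) hdot w (F i).
Proof. by elim/big_rec2: _ => [|i y1 y2 _ <-]; rewrite ?hdot0r ?hdotDr. Qed.
Lemma hdot_conj x y : hdot x y = (hdot y x)^*.
Proof. exact: dotC. Qed.

Lemma norm_hdot x y : `|hdot x y| <= `|x| * `|y|.
Proof.
rewrite -(@ler_pXn2r _ 2%N)// ?nnegrE ?mulr_ge0// exprMn -!hdotE.
exact: dot_CauchySchwarz.
Qed.

(** Pythagoras for the projection of [x] on the line of [y]. *)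
Lemma norm_sub_proj x y : y != 0 ->
  `|x - (hdot x y / `|y| ^+ 2) *: y| ^+ 2
  = `|x| ^+ 2 - `|hdot x y| ^+ 2 / `|y| ^+ 2.
Proof.
move=> y0; set h := hdot x y; set c := h / _.
have cE : c^* = h^* / `|y| ^+ 2.
  rewrite rmorphM /=; congr (_ * _); apply: geC0_conj.
  by rewrite invr_ge0 exprn_ge0.
rewrite -hdotE hdotBl !hdotBr !hdotZl !hdotZr (hdot_conj y) -/h cE !hdotE.
by rewrite normCK /c; field; rewrite normr_eq0.
Qed.

Lemma hdot_sep x : (forall y, hdot x y = 0) -> x = 0.
Proof.
move=> /(_ x) /eqP; rewrite hdotE sqrf_eq0 normr_eq0; exact: eqP.
Qed.

End HilbertSpace.

(** * Rates of convergence *)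

Section Rates.
Context {R : realType}.
Local Notation C := (Cplx R).

Lemma cvg_real_complex (g : nat -> R) :
  g @ \oo --> (0 : R) -> (fun n => (g n)%:C%C : C) @ \oo --> (0 : C).
Proof.
move=> /cvgrPdist_lt g0; apply/cvgrPdist_lt => -[e ei].
rewrite ltcE /= => /andP[/eqP ei0 e0]; subst ei.
apply: filterS (g0 _ e0) => n.
by rewrite !sub0r !normrN normc_def /= expr0n addr0 sqrtr_sqr ltcR.
Qed.

Definition rate (n : nat) : C := n.+1%:R^-1.

Lemma rate_gt0 n : 0 < rate n. Proof. by rewrite invr_gt0. Qed.

Lemma cvg_rate : rate @ \oo --> (0 : C).
Proof.
have := cvg_real_complex (@cvg_harmonic R : (fun n => n.+1%:R^-1 : R) @ \oo --> (0 : R)); apply: cvg_trans.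
by apply: near_eq_cvg; apply: nearW => n; rewrite /harmonic /= fmorphV /= rmorph_nat.
Qed.

Lemma cvg_geometricC (r : C) : 0 <= r -> r < 1 -> (fun n => r ^+ n) @ \oo --> (0 : C).
Proof.
case: r => a c; rewrite lecE ltcE /= => /andP[/eqP -> a0] /andP[_ a1].
have : (fun n => (a ^+ n) : R) @ \oo --> (0 : R) by apply: cvg_expr; rewrite ger0_norm.
move/cvg_real_complex; apply: cvg_trans.
by apply: near_eq_cvg; apply: nearW => n; rewrite rmorphXn.
Qed.

Lemma rate_le_eq0 (V : normedModType C) (x : V) (eps : nat -> C) (M : C) :
  eps @ \oo --> (0 : C) -> (forall n, `|x| <= M * eps n) -> x = 0.
Proof.
move=> e0 xe; have : (fun n => M * eps n) @ \oo --> (M * 0 : C) by exact: cvgMr.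
rewrite mulr0 => /C_ge_lim /(_ (nearW _ xe)); rewrite normr_le0; exact: eqP.
Qed.

Lemma rate_lt (eps : nat -> C) (e : C) : eps @ \oo --> (0 : C) ->
  (forall n, 0 <= eps n) -> 0 < e -> exists n, eps n < e.
Proof.
move=> /cvgrPdist_lt h eps0 e0; have [n hn] := filter_ex (h _ e0).
by exists n; move: hn; rewrite sub0r normrN ger0_norm.
Qed.

(** Quantitative completeness: the limit inherits the rate, so that later
    estimates are made on inequalities indexed by [n] and not on filters. *)
Lemma cauchy_rate (H : completeNormedModType C) (u : nat -> H) (eps : nat -> C) :
  eps @ \oo --> (0 : C) ->
  (forall m n, `|u m - u n| <= eps m + eps n) ->
  exists l, forall n, `|u n - l| <= eps n.
Proof.
move=> e0 ue.
have : cvg (u @ \oo).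
  apply: cauchy_cvg; apply/cauchy_ballP => e ep.
  have e2 : 0 < e / 2 by rewrite divr_gt0.
  move/cvgrPdist_lt : e0 => /(_ _ e2) e0.
  exists (u @` [set n | `|0 - eps n| < e / 2], u @` [set n | `|0 - eps n| < e / 2]).
    by split => /=; apply: filterS e0 => n ?; exists n.
  move=> [_ _] [/= [m lm <-] [n ln <-]] /=; rewrite -ball_normE /=.
  apply: le_lt_trans (ue _ _) _.
  have h k : 0 <= eps k.
    by have := ue k k; rewrite subrr normr0 -mulr2n pmulrn_lge0.
  move: lm ln; rewrite !sub0r !normrN !ger0_norm// => lm ln.
  by rewrite [ltRHS]splitr ltrD.
move=> /cvg_ex[l ul]; exists l => n.
have h : (fun m => `|u n - u m|) @ \oo --> `|u n - l|.
  by apply: cvg_norm; apply: cvgB; [exact: cvg_cst|exact: ul].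
have h2 : (fun m => eps n + eps m - `|u n - u m|) @ \oo --> (eps n + 0 - `|u n - l| : C).
  by apply: cvgB h; apply: cvgD e0; exact: cvg_cst.
have := C_ge_lim (M := 0) _ h2; rewrite addr0 subr_ge0; apply.
by apply: nearW => m; rewrite subr_ge0.
Qed.

End Rates.

(** * Total families span a dense subspace *)

Section TotalFamilies.
Context {R : realType} {X : Type}.
Local Notation C := (Cplx R).

Definition lincomb {V : lmodType C} (u : X -> V) (s : seq (C * X)) : V :=
  \sum_(a <- s) a.1 *: u a.2.

Definition total_family {H : hilbertSpace C} (u : X -> H) :=
  forall x, (forall z, hdot x (u z) = 0) -> x = 0.

Lemma lincombB (V : lmodType C) (u : X -> V) c s t :
  lincomb u s - c *: lincomb u t =
  lincomb u (s ++ [seq (- (c * a.1), a.2) | a <- t]).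
Proof.
rewrite /lincomb big_cat big_map /= scaler_sumr -sumrN; congr (_ + _).
by apply: eq_bigr => a _; rewrite scaleNr scalerA.
Qed.

(** The projection theorem for the span of [u].  A sequence of combinations that
    nearly minimises the distance to [x] leaves residues [f n] almost orthogonal
    to the span (otherwise a projection would shorten them); hence the residues
    are Cauchy, and their limit is orthogonal to the whole family. *)
Lemma total_dense (H : hilbertSpace C) (u : X -> H) x (e : C) :
  total_family u -> 0 < e -> exists s, `|x - lincomb u s| < e.
Proof.
move=> u_total e0.
pose q (y : H) : R := complex.Re (`|y| ^+ 2).
have qE y : (q y)%:C%C = `|y| ^+ 2 :> C.
  have : 0 <= `|y| ^+ 2 by rewrite exprn_ge0.
  by rewrite /q; case: (`|y| ^+ 2) => a c; rewrite lecE /= => /andP[/eqP -> _].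
pose E := [set q (x - lincomb u s) | s in [set: seq (C * X)]].
have E_inf : has_inf E.
  split; first by exists (q (x - lincomb u [::])); exists [::].
  by exists 0 => _ [s _ <-]; rewrite -lecR qE exprn_ge0.
pose D : C := (inf E)%:C%C.
have D_le s : D <= `|x - lincomb u s| ^+ 2.
  by rewrite -qE lecR; apply: ge_inf; [exact: E_inf.2|exists s].
have /choice[s sP] n : exists s, `|x - lincomb u s| ^+ 2 <= D + rate n ^+ 2.
  have r0 : (0 : R) < n.+1%:R^-1 ^+ 2 by rewrite exprn_gt0// invr_gt0.
  have [_ [s _ <-] /ltW] := inf_adherent r0 E_inf.
  rewrite -lecR qE rmorphD rmorphXn fmorphV rmorph_nat => h.
  by exists s.
pose f n := x - lincomb u (s n).
have f_orth n t : `|hdot (f n) (lincomb u t)| <= rate n * `|lincomb u t|.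
  set m := lincomb u t; have [->|m0] := eqVneq m 0.
    by rewrite hdot0r !normr0 mulr0.
  have mm0 : 0 < `|m| ^+ 2 by rewrite exprn_gt0// normr_gt0.
  set h := hdot (f n) m; pose c := h / `|m| ^+ 2.
  have := D_le (s n ++ [seq (- (- c * a.1), a.2) | a <- t]).
  rewrite -lincombB scaleNr opprK -/m opprD addrA -/(f n).
  rewrite norm_sub_proj// -/h => le1.
  rewrite -(@ler_pXn2r _ 2%N)// ?nnegrE ?mulr_ge0 ?(ltW (rate_gt0 _))// exprMn.
  rewrite -ler_pdivrMr//.
  have := le_trans le1 (lerB (sP n) (lexx _)).
  by rewrite -addrA lerDl subr_ge0.
have f_cauchy m n : `|f m - f n| <= rate m + rate n.
  have fE : f m - f n = lincomb u (s n ++ [seq (- (1 * a.1), a.2) | a <- s m]).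
    by rewrite -lincombB scale1r /f opprB addrC addrA subrK.
  set w := f m - f n; have [->|w0] := eqVneq w 0.
    by rewrite normr0 addr_ge0// ltW// rate_gt0.
  rewrite -(@ler_pM2r _ `|w|) ?normr_gt0// -expr2 -hdotE.
  rewrite {1}/w hdotBl mulrDl.
  have := hdotE w; set k := hdot w w => kE.
  have : `|hdot (f m) w - hdot (f n) w| <= rate m * `|w| + rate n * `|w|.
    by apply: le_trans (ler_normB _ _) _; rewrite lerD// /w fE f_orth.
  by apply: le_trans; rewrite -hdotBl -/w -/k ger0_norm// kE exprn_ge0.
have [l fl] := cauchy_rate cvg_rate f_cauchy.
have l0 : l = 0.
  (* the residues are within [rate n] of [l] and [rate n]-orthogonal to [u z] *)
  apply: u_total => z; apply: (@rate_le_eq0 _ C _ _ (2 * `|u z|) cvg_rate) => n.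
  rewrite (_ : hdot l _ = hdot (f n) (u z) - hdot (f n - l) (u z)); last first.
    by rewrite (hdotBl (f n) l) subKr.
  apply: le_trans (ler_normB _ _) _; rewrite mulrC mulrA mulrDr mulr1 mulrDl.
  rewrite lerD//; last first.
    by apply: le_trans (norm_hdot _ _) _; rewrite ler_wpM2r.
  by have := f_orth n [:: (1, z)]; rewrite /lincomb big_seq1 scale1r.
have [n ne] := rate_lt cvg_rate (fun n => ltW (rate_gt0 n)) e0.
by exists (s n); apply: le_lt_trans ne; have := fl n; rewrite l0 subr0.
Qed.

End TotalFamilies.

(** * Unitaries between total families with equal Gram matrices *)

Section GramUnitary.
Context {R : realType} {X : Type}.
Local Notation C := (Cplx R).

Lemma hdot_close (H : hilbertSpace C) (x x' a a' : H) n :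
  `|x - a| <= rate n -> `|x' - a'| <= rate n ->
  `|hdot x x' - hdot a a'| <= (`|x'| + (`|x| + 1)) * rate n.
Proof.
move=> xa xa'.
have a_le : `|a| <= `|x| + 1.
  rewrite -[a](subKr x); apply: le_trans (ler_normB _ _) _; rewrite lerD2l.
  by apply: le_trans xa _; rewrite invf_le1// ler1n.
rewrite (_ : _ - _ = hdot (x - a) x' + hdot a (x' - a')); last first.
  by rewrite hdotBl hdotBr addrA subrK.
apply: le_trans (ler_normD _ _) _; rewrite mulrDl lerD//.
  by apply: le_trans (norm_hdot _ _) _; rewrite mulrC ler_wpM2l.
by apply: le_trans (norm_hdot _ _) _; rewrite ler_pM.
Qed.

(** [(x, y)] lies in the closure of the graph of the map sending each
    combination of the [u z] to the same combination of the [v z]. *)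
Definition matching {H1 H2 : hilbertSpace C} (u : X -> H1) (v : X -> H2) x y :=
  forall n, exists s, `|x - lincomb u s| <= rate n /\ `|y - lincomb v s| <= rate n.

Lemma matching_sym (H1 H2 : hilbertSpace C) (u : X -> H1) (v : X -> H2) x y :
  matching u v x y -> matching v u y x.
Proof. by move=> xy n; have [s []] := xy n; exists s. Qed.

Lemma matching_family (H1 H2 : hilbertSpace C) (u : X -> H1) (v : X -> H2) z :
  matching u v (u z) (v z).
Proof.
move=> n; exists [:: (1, z)].
by rewrite /lincomb !big_seq1 !scale1r !subrr !normr0 ltW// rate_gt0.
Qed.

Section Match.
Context {H1 H2 : hilbertSpace C} {u : X -> H1} {v : X -> H2}.
Hypothesis gram : forall w z, hdot (u w) (u z) = hdot (v w) (v z).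

Lemma lincomb_gram s t :
  hdot (lincomb u s) (lincomb u t) = hdot (lincomb v s) (lincomb v t).
Proof.
rewrite /lincomb !hdot_suml; apply: eq_bigr => a _.
rewrite !hdot_sumr; apply: eq_bigr => c _.
by rewrite !hdotZl !hdotZr gram.
Qed.

Lemma matching_dot x y x' y' :
  matching u v x y -> matching u v x' y' -> hdot x x' = hdot y y'.
Proof.
move=> xy xy'; apply/eqP; rewrite -subr_eq0; apply/eqP.
apply: (@rate_le_eq0 _ C _ _ _ cvg_rate) => n.
have [s [xs ys]] := xy n; have [t [xt yt]] := xy' n.
apply: (le_trans _ (_ : (`|x'| + (`|x| + 1)) * rate n
  + (`|y'| + (`|y| + 1)) * rate n <= _)); last by rewrite -mulrDl.
apply: le_trans (lerD (hdot_close xs xt) (hdot_close ys yt)).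
rewrite lincomb_gram; apply: le_trans (ler_normB _ _).
by rewrite opprB addrA subrK.
Qed.

(** The combinations that approximate [x] have coefficients whose counterparts
    in the other space are Cauchy as well, the Gram matrices being equal. *)
Lemma matching_exists : total_family u -> forall x, exists y, matching u v x y.
Proof.
move=> u_total x.
have /choice[s sP] n : exists s, `|x - lincomb u s| <= rate n.
  have [s /ltW] := total_dense x u_total (rate_gt0 n).
  by exists s.
have ys m n : `|lincomb v (s m) - lincomb v (s n)| <= rate m + rate n.
  rewrite -[lincomb v (s n)]scale1r lincombB.
  rewrite -(@ler_pXn2r _ 2%N)// ?nnegrE ?addr_ge0 ?(ltW (rate_gt0 _))//.
  rewrite -hdotE -lincomb_gram hdotE lerXn2r ?nnegrE ?addr_ge0 ?(ltW (rate_gt0 _))//.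
  rewrite -lincombB scale1r.
  rewrite (_ : _ - _ = (x - lincomb u (s n)) - (x - lincomb u (s m))); last first.
    by rewrite opprB [RHS]addrC addrA subrK.
  by apply: le_trans (ler_normB _ _) _; rewrite addrC lerD.
have [y yP] := cauchy_rate cvg_rate ys.
by exists y => n; exists (s n); rewrite distrC (distrC y); split=> //; rewrite distrC.
Qed.

End Match.

(** The closed graph [matching] is functional because [v] is total, everywhere
    defined because [u] is total, and symmetric in the two spaces. *)
Lemma unitary_of_gram (H1 H2 : hilbertSpace C) (u : X -> H1) (v : X -> H2) :
  total_family u -> total_family v ->
  (forall w z, hdot (u w) (u z) = hdot (v w) (v z)) ->
  exists U : {linear H1 -> H2}, unitary U /\
    forall x z, hdot (U x) (v z) = hdot x (u z).
Proof.
move=> u_total v_total gram.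
have /choice[U UP] := matching_exists gram u_total.
have U_v x z : hdot (U x) (v z) = hdot x (u z).
  by rewrite (matching_dot gram (UP x) (matching_family u v z)).
have v_sep y y' : (forall z, hdot y (v z) = hdot y' (v z)) -> y = y'.
  move=> yy'; apply/eqP; rewrite -subr_eq0; apply/eqP/v_total => z.
  by rewrite hdotBl yy' subrr.
have U_lin : linear U.
  move=> a x y; apply: v_sep => z.
  by rewrite hdotDl hdotZl !U_v hdotDl hdotZl.
exists (HB.pack_for {linear H1 -> H2} U (GRing.isLinear.Build C H1 H2 *:%R U U_lin)).
split=> //; split=> [x y|y] /=; first by rewrite -(matching_dot gram (UP x) (UP y)).
have [x yx] := matching_exists (fun w z => esym (gram w z)) v_total y.
exists x; apply: v_sep => z; rewrite U_v.
exact: matching_dot gram _ _ _ _ (matching_sym yx) (matching_family u v z).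
Qed.

End GramUnitary.

(** * Adjoints, norm closures and Neumann series *)

Section Operators.
Context {R : realType} {H : hilbertSpace (Cplx R)}.
Local Notation C := (Cplx R).
Implicit Types (T U : H -> H) (A : set (H -> H)).

Definition linear_of T (hT : linear T) : {linear H -> H} :=
  HB.pack_for {linear H -> H} T (GRing.isLinear.Build C H H *:%R T hT).

Lemma linear_opZ T : linear T -> forall a x, T (a *: x) = a *: T x.
Proof. by move=> hT a x; exact: (linearZ_LR (linear_of hT)). Qed.

Lemma linear_op_sum T : linear T -> forall I (r : seq I) (P : pred I) (F : I -> H),
  T (\sum_(i <- r | P i) F i) = \sum_(i <- r | P i) T (F i).
Proof. by move=> hT I r P F; exact: (linear_sum (linear_of hT)). Qed.

Definition is_adjoint T T' := forall x y, hdot (T x) y = hdot x (T' y).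

Definition op_bound (M : C) T := forall x, `|T x| <= M * `|x|.

Lemma is_adjoint_sym T T' : is_adjoint T T' -> is_adjoint T' T.
Proof. by move=> TT' x y; rewrite hdot_conj -TT' -hdot_conj. Qed.

Lemma is_adjoint_unique T T' T'' :
  is_adjoint T T' -> is_adjoint T T'' -> T' = T''.
Proof.
move=> h1 h2; apply/funext => y; apply/eqP; rewrite -subr_eq0; apply/eqP.
by apply: hdot_sep => x; rewrite hdotBl hdot_conj -h1 h2 -hdot_conj subrr.
Qed.

Lemma adjointE T T' : is_adjoint T T' -> adjoint T = T'.
Proof.
move=> TT'; apply: (is_adjoint_unique _ TT').
exact: (@xgetPex _ 0 [set T'0 | is_adjoint T T'0] (ex_intro _ T' TT')).
Qed.

Lemma is_adjoint_linear T T' : is_adjoint T T' -> linear T.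
Proof.
move=> TT' a x y; apply/eqP; rewrite -subr_eq0; apply/eqP; apply: hdot_sep => w.
by rewrite hdotBl hdotDl hdotZl !TT' hdotDl hdotZl subrr.
Qed.

Lemma is_adjoint_lin (a : C) T T' U U' : is_adjoint T T' -> is_adjoint U U' ->
  is_adjoint (a *: T + U) (a^* *: T' + U').
Proof.
move=> TT' UU' x y.
rewrite !fctE hdotDl hdotDr hdotZl hdotZr conjCK.
by rewrite TT' UU'.
Qed.

Lemma is_adjoint_id : is_adjoint idfun idfun.
Proof. by []. Qed.

Lemma is_adjoint_iter T T' n : is_adjoint T T' -> is_adjoint (iter n T) (iter n T').
Proof.
move=> TT'; elim: n => // n ih x y.
by rewrite iterS TT' ih iterSr.
Qed.

Lemma is_adjoint_bound (M : C) T T' : 0 <= M ->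
  is_adjoint T T' -> op_bound M T -> op_bound M T'.
Proof.
move=> M0 TT' TM y; have [->|y0] := eqVneq (T' y) 0; first by rewrite normr0 mulr_ge0.
rewrite -(@ler_pM2r _ `|T' y|) ?normr_gt0// -expr2 -hdotE -TT'.
apply: le_trans (_ : `|hdot (T (T' y)) y| <= _).
  by rewrite ger0_norm// TT' hdotE exprn_ge0.
apply: le_trans (norm_hdot _ _) _.
by rewrite mulrAC ler_wpM2r.
Qed.

Lemma bounded_op_le T : bounded_op T -> exists2 M, 0 <= M & op_bound M T.
Proof.
move=> [_ [M TM]]; exists `|M| => // x; apply: le_trans (TM x) _.
have [->|x0] := eqVneq x 0; first by rewrite normr0 !mulr0.
have xx : 0 < `|x| by rewrite normr_gt0.
rewrite ler_pM2r//; have : 0 <= M * `|x| := le_trans (normr_ge0 _) (TM x).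
by rewrite pmulr_lge0// => M0; rewrite ger0_norm.
Qed.

Definition op_subspace A := A 0 /\ forall a T U, A T -> A U -> A (a *: T + U).

Lemma bounded_op_subspace : op_subspace (@bounded_op _ H).
Proof.
split.
  split; first by move=> a x y; change ((0 : H) = a *: (0 : H) + 0); rewrite scaler0 addr0.
  by exists 0 => x; change (`|0 : H| <= 0 * `|x|); rewrite normr0 mul0r.
move=> a T U bT bU; split.
  move=> c x y; rewrite !fctE bT.1 bU.1 !scalerDr !scalerA (mulrC a) -!addrA.
  by congr (_ + _); rewrite addrCA.
have [M M0 TM] := bounded_op_le bT; have [N N0 UN] := bounded_op_le bU.
exists (`|a| * M + N) => x; rewrite !fctE; apply: le_trans (ler_normD _ _) _.
by rewrite mulrDl lerD// normrZ -mulrA ler_wpM2l.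
Qed.

Lemma norm_closure_subspace A : op_subspace A -> op_subspace (norm_closure A).
Proof.
move=> [A0 AD]; split.
  split; first exact: bounded_op_subspace.1.
  by move=> e e0; exists 0 => // x; rewrite subrr normr0 mulr_ge0// ltW.
move=> a T U [bT cT] [bU cU]; split; first exact: bounded_op_subspace.2.
move=> e e0; have e2 : 0 < e / 2 by rewrite divr_gt0.
have a1 : 0 < `|a| + 1 by rewrite ltr_wpDl.
have [T1 AT1 TT1] := cT (e / 2 / (`|a| + 1)) (divr_gt0 e2 a1).
have [U1 AU1 UU1] := cU _ e2.
exists (a *: T1 + U1); first exact: AD.
move=> x; rewrite !fctE opprD addrACA -scalerBr.
apply: le_trans (ler_normD _ _) _.
rewrite [e]splitr mulrDl; apply: lerD => //.
rewrite normrZ; apply: le_trans (ler_wpM2l (normr_ge0 a) (TT1 x)) _.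
rewrite mulrA ler_wpM2r// mulrCA ler_piMr ?(ltW e2)//.
by rewrite ler_pdivrMr// mul1r lerDl.
Qed.

Lemma sub_norm_closure A : A `<=` @bounded_op _ H -> A `<=` norm_closure A.
Proof.
move=> Ab T AT; split; first exact: Ab.
by move=> e e0; exists T => // x; rewrite subrr normr0 mulr_ge0// ltW.
Qed.

(** If the [U n] converge to [T] in norm, their adjoints are Cauchy at the same
    rate, since an operator and its adjoint have the same bounds. *)
Lemma norm_closure_adjoint A :
  (forall T, A T -> exists T', is_adjoint T T') ->
  forall T, norm_closure A T -> exists T', is_adjoint T T'.
Proof.
move=> Aadj T [bT cT].
have /choice[U UP] n : exists U, A U /\ op_bound (rate n) (T - U).
  by have [U AU TU] := cT _ (rate_gt0 n); exists U; split=> // x; rewrite !fctE.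
have /choice[U' U'P] n := Aadj _ (UP n).1.
have U'c y m n : `|U' m y - U' n y| <= rate m * `|y| + rate n * `|y|.
  have adj : is_adjoint (-1 *: U n + U m) (-1 *: U' n + U' m).
    by have := is_adjoint_lin (-1) (U'P n) (U'P m); rewrite rmorphN rmorph1.
  have rmn : 0 <= rate m + rate n :> C by rewrite addr_ge0// ltW// rate_gt0.
  have bnd : op_bound (rate m + rate n) (-1 *: U n + U m).
    move=> x; rewrite (_ : _ x = (T - U n) x - (T - U m) x); last first.
      by rewrite !fctE scaleN1r opprB [RHS]addrC addrA subrK addrC.
    apply: le_trans (ler_normB _ _) _.
    by rewrite addrC mulrDl lerD//; apply: (UP _).2.
  have := is_adjoint_bound rmn adj bnd y.
  by rewrite !fctE scaleN1r addrC mulrDl.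
have yrate (y : H) : (fun n => rate n * `|y|) @ \oo --> (0 : C).
  rewrite (_ : 0 = 0 * `|y|); last by rewrite mul0r.
  by apply: cvgMl; exact: cvg_rate.
have /choice[T' T'P] y := cauchy_rate (yrate y) (U'c y).
exists T' => x y; apply/eqP; rewrite -subr_eq0; apply/eqP.
apply: (@rate_le_eq0 _ C _ _ (2 * (`|x| * `|y|)) cvg_rate) => n.
rewrite (_ : _ - _ = hdot ((T - U n) x) y + hdot x (U' n y - T' y)); last first.
  by rewrite !fctE hdotBl hdotBr (U'P n) addrA subrK.
apply: le_trans (ler_normD _ _) _.
rewrite mulr_natl mulr2n mulrDl; apply: lerD; apply: le_trans (norm_hdot _ _) _.
  by rewrite mulrC -mulrA [leRHS]mulrCA ler_wpM2l// mulrC; apply: (UP n).2.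
by rewrite -mulrA ler_wpM2l// mulrC; exact: T'P.
Qed.

Lemma inverse_opE T T' : bounded_op T' -> T' \o T = idfun -> T \o T' = idfun ->
  inverse_op T = T'.
Proof.
move=> bT' T'T TT'; rewrite /inverse_op; set P := [set _ | _].
have PT' : P T' by [].
have [_ [_ h]] : P (xget 0 P) := @xgetPex _ 0 P (ex_intro _ T' PT').
apply/funext => x.
have := congr1 (fun f => T' (f x)) h; rewrite /=.
by have := congr1 (fun f => f (xget 0 P x)) T'T; rewrite /= => ->.
Qed.

(** The partial sums [u x n] satisfy [(I - T) (u x n) = x - T^n x], and [I - T] is
    bounded below by [1 - r]: this gives their convergence, and then both
    inverse identities, the second by injectivity of [I - T]. *)
Lemma neumann T (r : C) : linear T -> 0 <= r -> r < 1 -> op_bound r T ->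
  exists K, [/\ linear K, (forall x, K x - T (K x) = x),
    (forall x, K (x - T x) = x) &
    forall n x, `|K x - \sum_(k < n) iter k T x| <= r ^+ n / (1 - r) * `|x|].
Proof.
move=> T_lin r0 r1 Tr; pose L := linear_of T_lin.
have LE x : T x = L x by [].
have s0 : 0 < 1 - r by rewrite subr_gt0.
have lower x : (1 - r) * `|x| <= `|x - T x|.
  rewrite mulrBl mul1r; apply: le_trans (lerB (lexx _) (Tr x)) _.
  exact: lerB_dist.
have sub_lin x y : (x - y) - T (x - y) = (x - T x) - (y - T y).
  by rewrite !LE linearB opprD addrACA -opprD.
have sub_inj x y : x - T x = y - T y -> x = y.
  move=> xy; apply/eqP; rewrite -subr_eq0 -normr_le0 -(pmulr_rle0 _ s0).
  by apply: le_trans (lower _) _; rewrite sub_lin xy subrr normr0.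
have iter_le n x : `|iter n T x| <= r ^+ n * `|x|.
  elim: n => [|n ih]; first by rewrite mul1r.
  by apply: le_trans (Tr _) _; rewrite exprS -mulrA ler_wpM2l.
pose u x n := \sum_(k < n) iter k T x.
have uE x n : u x n - T (u x n) = x - iter n T x.
  rewrite /u; elim: n => [|n ih]; first by rewrite big_ord0 LE linear0 !subrr.
  rewrite big_ord_recr /= LE linearD /= opprD addrACA ih.
  by rewrite addrA subrK.
have u_dist x m n : `|u x m - u x n|
    <= r ^+ m / (1 - r) * `|x| + r ^+ n / (1 - r) * `|x|.
  rewrite -mulrDl -mulrDl mulrAC ler_pdivlMr// (mulrC _ (1 - r)).
  apply: le_trans (lower _) _; rewrite sub_lin !uE opprD addrACA subrr add0r opprK addrC.
  apply: le_trans (ler_normB _ _) _.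
  by rewrite mulrDl addrC lerD.
have u_rate (x : H) : (fun n => r ^+ n / (1 - r) * `|x|) @ \oo --> (0 : C).
  rewrite (_ : 0 = 0 / (1 - r) * `|x|); last by rewrite !mul0r.
  by apply: cvgMl; apply: cvgMl; exact: cvg_geometricC.
have /choice[K KP] x := cauchy_rate (u_rate x) (u_dist x).
have KT x : K x - T (K x) = x.
  apply/eqP; rewrite -subr_eq0; apply/eqP.
  apply: (@rate_le_eq0 _ H _ _ ((1 + r) / (1 - r) * `|x| + `|x|)
    (cvg_geometricC r0 r1)) => n.
  rewrite (_ : K x - T (K x) - x = ((K x - u x n) - T (K x - u x n)) - iter n T x); last first.
    rewrite sub_lin uE; move: (_ - T (K x)) (iter n T x) => a i.
    by rewrite opprB addrA [RHS]addrAC addrK.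
  apply: le_trans (ler_normB _ _) _; rewrite mulrDl lerD//; last first.
    by rewrite mulrC.
  have KPn : `|K x - u x n| <= r ^+ n / (1 - r) * `|x| by rewrite distrC.
  apply: le_trans (ler_normB _ _) _; apply: le_trans (lerD (lexx _) (Tr _)) _.
  rewrite -{1}[`|_|]mul1r -mulrDl.
  apply: le_trans (ler_wpM2l _ KPn) _; first by rewrite addr_ge0.
  by rewrite le_eqVlt; apply/orP; left; apply/eqP; field; rewrite subr_eq0 eq_sym lt_eqF.
exists K; split=> //.
- move=> a x y; apply: sub_inj.
  rewrite KT (LE (_ + _)) linearP /=.
  by rewrite opprD addrACA -scalerBr !KT.
- by move=> x; apply: sub_inj; rewrite KT.
- by move=> n x; rewrite distrC; exact: KP.
Qed.

End Operators.

(** * Linear combinations of creation operators and their powers *)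

Section CreationOperators.
Context {R : realType} {d : nat}.
Local Notation C := (Cplx R).
Local Notation word := (seq 'I_d).
Local Notation F2 := (ell2 R d).
Local Notation shift := (@Defs.shift R d).
Implicit Types (c : 'I_d -> C) (f g : F2).

Lemma unshift_fun_l2 (i : 'I_d) (f : l2 R d) :
  (fun w => f (i :: w)) \in @square_summable R d.
Proof.
have [M fM] := l2P f; apply/asboolP; exists M => N.
apply: le_trans (fM N.+1); rewrite psumS (bigD1 i)//= addrCA lerDl addr_ge0//.
by apply: sumr_ge0 => j _; apply: psum_ge0 => w; rewrite exprn_ge0.
Qed.

Definition unshift (i : 'I_d) : F2 -> F2 := fun f => L2 (unshift_fun_l2 i f).

Lemma unshift_shift i j f : unshift i (shift j f) = (i == j)%:R *: f.
Proof.
apply: l2_ext => w; rewrite /=.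
by have [_|_] := eqVneq; rewrite /= ?scale1r ?scale0r.
Qed.

Lemma shift_adjoint i : is_adjoint (shift i) (unshift i).
Proof.
move=> f g; change (l2_dot (shift i f) g = l2_dot f (unshift i g)).
apply: (limC_unique _ (@l2_dot_cvg R d f (unshift i g))).
have := @l2_dot_cvg R d (shift i f) g; rewrite -cvg_shiftS; apply: cvg_trans.
apply: near_eq_cvg; apply: nearW => N /=.
rewrite psumS /= mul0r add0r (bigD1 i)//= eqxx big1 ?addr0// => j /negbTE ji.
rewrite ji /psum big1// => n _; rewrite big1// => t _; by rewrite mul0r.
Qed.

Definition creation c : F2 -> F2 := \sum_j c j *: shift j.
Definition annihilation c : F2 -> F2 := \sum_j (c j)^* *: unshift j.

Lemma creationE c f : creation c f = \sum_j c j *: shift j f.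
Proof. by rewrite /creation fct_sumE; apply: eq_bigr. Qed.
Lemma annihilationE c f : annihilation c f = \sum_j (c j)^* *: unshift j f.
Proof. by rewrite /annihilation fct_sumE; apply: eq_bigr. Qed.

Lemma creation_adjoint c : is_adjoint (creation c) (annihilation c).
Proof.
move=> f g; rewrite creationE annihilationE hdot_suml hdot_sumr.
apply: eq_bigr => j _; rewrite hdotZl hdotZr conjCK; congr (_ * _).
exact: shift_adjoint.
Qed.

Lemma creation_linear c : linear (creation c).
Proof. exact: is_adjoint_linear (creation_adjoint c). Qed.
Lemma annihilation_linear c : linear (annihilation c).
Proof. exact: is_adjoint_linear (is_adjoint_sym (creation_adjoint c)). Qed.

(** This is where [L_i^* L_j = \delta_ij] enters. *)
Lemma annihilation_creation c c' f :
  annihilation c (creation c' f) = (\sum_j (c j)^* * c' j) *: f.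
Proof.
rewrite annihilationE scaler_suml; apply: eq_bigr => j _.
rewrite creationE (_ : unshift j _ = c' j *: f) ?scalerA//.
have uL : linear (unshift j) := is_adjoint_linear (is_adjoint_sym (shift_adjoint j)).
rewrite (linear_op_sum uL) (bigD1 j)//= (linear_opZ uL) big1 => [|i ij].
  by rewrite addr0 unshift_shift eqxx scale1r.
by rewrite (linear_opZ uL) unshift_shift eq_sym (negbTE ij) scale0r scaler0.
Qed.

Lemma norm_creation c f : `|creation c f| ^+ 2 = (\sum_j `|c j| ^+ 2) * `|f| ^+ 2.
Proof.
rewrite -!hdotE creation_adjoint annihilation_creation hdotZr rmorph_sum.
by congr (_ * _); apply: eq_bigr => j _; rewrite normCK rmorphM /= conjCK.
Qed.

Lemma creationZ (a : C) c : creation (fun j => a * c j) = a *: creation c.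
Proof.
apply/funext => f; rewrite !fctE !creationE scaler_sumr.
by apply: eq_bigr => j _; rewrite scalerA.
Qed.

Lemma iter_creationZ (a : C) c m :
  iter m (creation (fun j => a * c j)) = a ^+ m *: iter m (creation c).
Proof.
elim: m => [|m ih]; apply/funext => f; first by rewrite !fctE scale1r.
by rewrite iterS ih creationZ !fctE (linear_opZ (creation_linear c)) scalerA -exprS.
Qed.

Lemma iter_creation_words c m f :
  iter m (creation c) f =
  \sum_(w : m.-tuple 'I_d) (\prod_(i <- w) c i) *: word_op w f.
Proof.
elim: m => [|m ih].
  rewrite (big_pred1 [tuple]) => [|t]; last by apply/esym/eqP; exact: tuple0.
  by rewrite big_nil scale1r.
rewrite iterS ih creationE.
rewrite [RHS](reindex (fun p : 'I_d * m.-tuple 'I_d => [tuple of p.1 :: p.2])) /=; last first.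
  exists (fun t : m.+1.-tuple 'I_d => (thead t, [tuple of behead t])) => [[i t] _|t _] /=.
    by congr (_, _); apply: val_inj.
  by rewrite [RHS]tuple_eta; apply: val_inj.
rewrite -(pair_bigA _ (fun (i : 'I_d) (t : m.-tuple 'I_d) => (\prod_(k <- i :: t) c k) *: shift i (word_op t f))) /=.
apply: eq_bigr => i _.
have sL : linear (shift i) := is_adjoint_linear (shift_adjoint i).
rewrite (linear_op_sum sL) scaler_sumr; apply: eq_bigr => t _.
by rewrite (linear_opZ sL) scalerA big_cons.
Qed.

Lemma sym_op_tuple (n : 'I_d -> nat) m : (\sum_i n i)%N = m ->
  @sym_op R d n = \sum_(w : m.-tuple 'I_d | [forall i, count_mem i w == n i]) word_op w.
Proof. by move=> <-. Qed.

Definition multidegree m := {ffun 'I_d -> 'I_m.+1}.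

Lemma sum_count_mem (s : word) : (\sum_i count_mem i s)%N = size s.
Proof.
elim: s => [|j s ih] /=; first by rewrite big1.
rewrite big_split /= ih (bigD1 j)//= eqxx big1 => [|i /negbTE ij].
  by rewrite addn0 add1n.
by rewrite eq_sym ij.
Qed.

Lemma prod_count_mem (s : word) c : \prod_(i <- s) c i = \prod_i c i ^+ count_mem i s.
Proof.
elim: s => [|j s ih]; first by rewrite big_nil big1.
rewrite big_cons ih [RHS](bigD1 j)//= eqxx add1n exprS [in LHS](bigD1 j)//= -!mulrA.
congr (_ * (_ * _)); apply: eq_bigr => i /negbTE ij.
by rewrite eq_sym ij.
Qed.

(** The noncommutative multinomial formula: a word contributes a coefficient
    that depends only on its letter counts, so the words group into the
    symmetric sums [sym_op]. *)
Lemma iter_creation_sym c m :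
  iter m (creation c) =
  \sum_(v : multidegree m | (\sum_i v i)%N == m)
     (\prod_i c i ^+ v i) *: sym_op (fun i => v i).
Proof.
apply/funext => f; rewrite iter_creation_words fct_sumE.
pose cnt (w : m.-tuple 'I_d) : multidegree m := [ffun i => inord (count_mem i w)].
have cntE w i : cnt w i = count_mem i w :> nat.
  by rewrite ffunE inordK// ltnS -[X in (_ <= X)%N](size_tuple w) count_size.
rewrite (partition_big cnt (fun v => (\sum_i v i)%N == m)) => [|w _]; last first.
  by rewrite (eq_bigr _ (fun i _ => cntE w i)) sum_count_mem size_tuple.
apply: eq_bigr => v /eqP vm.
rewrite (sym_op_tuple vm) !fctE fct_sumE scaler_sumr; apply: eq_big => w.
  apply/eqP/forallP => [<- i|h]; first by rewrite cntE.
  by apply/ffunP => i; apply: ord_inj; rewrite cntE; apply/eqP.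
move=> /eqP <-; rewrite prod_count_mem; congr (_ *: _).
by apply: eq_bigr => i _; rewrite cntE.
Qed.

Lemma kronecker_inj (M : nat) n (u v : nat -> nat) :
  (forall i, (i < n)%N -> (u i < M)%N) -> (forall i, (i < n)%N -> (v i < M)%N) ->
  (\sum_(i < n) u i * M ^ i)%N = (\sum_(i < n) v i * M ^ i)%N ->
  forall i, (i < n)%N -> u i = v i.
Proof.
elim: n u v => // n ih u v uM vM.
have digits (x : nat -> nat) :
    (\sum_(i < n.+1) x i * M ^ i = x 0 + M * \sum_(i < n) x i.+1 * M ^ i)%N.
  rewrite big_ord_recl expn0 muln1 big_distrr /=; congr (_ + _)%N.
  by apply: eq_bigr => i _; rewrite expnS mulnCA.
rewrite !digits => e.
have M0 : (0 < M)%N by apply: leq_ltn_trans (uM 0 _).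
have e0 : u 0 = v 0.
  have := congr1 (modn^~ M) e; rewrite /= ![(_ + M * _)%N]addnC.
  by rewrite ![(M * _)%N]mulnC !modnMDl !modn_small ?uM ?vM.
move: e => /eqP; rewrite e0 eqn_add2l eqn_pmul2l// => /eqP e [_//|i] iN.
by apply: (ih (u \o succn) (v \o succn)) => // j jn; [apply: uM|apply: vM].
Qed.

(** Evaluation at [N] distinct points determines the coefficients of a
    polynomial of degree less than [N]; the [a k] are a column of the inverse
    Vandermonde matrix. *)
Lemma monomial_dual N (e0 : nat) : (e0 < N)%N ->
  exists a : 'I_N -> C, forall e, (e < N)%N ->
    \sum_(k < N) a k * (k%:R : C) ^+ e = (e == e0)%:R.
Proof.
move=> e0N; pose V : 'M[C]_N := Vandermonde N (\row_k (k : nat)%:R).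
have Vu : V \in unitmx.
  rewrite unitmxE det_Vandermonde unitfE.
  apply/prodf_neq0 => i _; apply/prodf_neq0 => j ij.
  by rewrite !mxE subr_eq0 eqr_nat gtn_eqF.
exists (fun k => invmx V k (Ordinal e0N)) => e eN.
have := congr1 (fun A : 'M[C]_N => A (Ordinal eN) (Ordinal e0N)) (mulmxV Vu).
rewrite !mxE -val_eqE /= => <-.
by apply: eq_bigr => k _; rewrite !mxE mulrC.
Qed.

(** Kronecker substitution: for [c_i = k ^ ((m + 1) ^ i)] the monomials of
    multidegree [v] with [|v| = m] become distinct powers of [k], and a single
    one is extracted by [monomial_dual]. *)
Lemma sym_op_span (n : 'I_d -> nat) : exists s : seq (C * ('I_d -> C)),
  sym_op n = \sum_(a <- s) a.1 *: iter (\sum_i n i)%N (creation a.2).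
Proof.
set m := (\sum_i n i)%N.
have n_le i : (n i < m.+1)%N by rewrite ltnS /m (bigD1 i)//= leq_addr.
pose code (v : multidegree m) : nat := (\sum_i v i * m.+1 ^ i)%N.
pose v0 : multidegree m := [ffun i => Ordinal (n_le i)].
have code_inj v : code v = code v0 -> v = v0.
  pose ext (x : multidegree m) i : nat := oapp x ord0 (insub i).
  have extE (x : multidegree m) (i : 'I_d) : ext x i = x i by rewrite /ext valK.
  have codeE (x : multidegree m) : code x = (\sum_(i < d) ext x i * m.+1 ^ i)%N.
    by apply: eq_bigr => i _; rewrite extE.
  rewrite !codeE => /kronecker_inj h; apply/ffunP => i; apply: val_inj => /=.
  by rewrite -!extE; apply: h => // j _; rewrite /ext; case: insub => /=.
(* more nodes than the largest exponent that occurs *)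
pose N := (\max_v code v).+1.
have codeN v : (code v < N)%N by rewrite ltnS; exact: leq_bigmax.
have [a aP] := monomial_dual (codeN v0).
exists [seq (a k, fun i : 'I_d => (k%:R : C) ^+ (m.+1 ^ i)) | k : 'I_N].
rewrite big_image /=; apply/esym.
under eq_bigr => k _ do rewrite iter_creation_sym scaler_sumr.
rewrite exchange_big /= (bigD1 v0) /=; last first.
  by apply/eqP; apply: eq_bigr => i _; rewrite ffunE.
have coef (v : multidegree m) : \sum_(k < N) a k *: ((\prod_(i < d) (k%:R ^+ (m.+1 ^ i)) ^+ v i) *: sym_op (fun i => v i))
    = (code v == code v0)%:R *: @sym_op R d (fun i => v i).
  rewrite -(aP _ (codeN v)) scaler_suml; apply: eq_bigr => k _.
  rewrite scalerA; congr (_ * _ *: _).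
  rewrite -prodrXr; apply: eq_bigr => i _.
  by rewrite -exprM mulnC.
rewrite coef eqxx scale1r big1 ?addr0 => [|v /andP[_ vv0]].
  by congr sym_op; apply/funext => i; rewrite ffunE.
rewrite coef; case: eqP => [/code_inj vE|]; last by rewrite scale0r.
by rewrite vE eqxx in vv0.
Qed.

End CreationOperators.

(** * Products q^* p of polynomials, and positive functionals on them *)

Section OperatorSystem.
Context {R : realType} {d : nat}.
Local Notation C := (Cplx R).
Local Notation F2 := (ell2 R d).
Implicit Types (c : 'I_d -> C) (p q T U : F2 -> F2) (A : set (F2 -> F2)).

Lemma op_subspaceZ A a T : op_subspace A -> A T -> A (a *: T).
Proof. by move=> [A0 AD] AT; rewrite -[_ *: _]addr0; exact: AD. Qed.

Lemma op_subspace_sum A I (r : seq I) (P : pred I) (F : I -> F2 -> F2) :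
  op_subspace A -> (forall i, P i -> A (F i)) -> A (\sum_(i <- r | P i) F i).
Proof.
move=> [A0 AD] AF; elim/big_rec: _ => // i T Pi AT.
by rewrite -[F i]scale1r; apply: AD => //; exact: AF.
Qed.

Lemma nc_poly_subspace : op_subspace (@nc_poly R d).
Proof.
split; first by exists [::]; rewrite big_nil.
move=> a _ _ [s ->] [t ->].
exists ([seq (a * x.1, x.2) | x <- s] ++ t).
rewrite big_cat big_map /= scaler_sumr; congr (_ + _).
by apply: eq_bigr => x _; rewrite scalerA.
Qed.

Lemma nc_poly_sym n : nc_poly (@sym_op R d n).
Proof. by exists [:: (1, n)]; rewrite big_seq1 scale1r. Qed.

Lemma nc_poly_iter m c : nc_poly (iter m (creation c)).
Proof.
rewrite iter_creation_sym; apply: op_subspace_sum nc_poly_subspace _ => v _.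
by apply: op_subspaceZ nc_poly_subspace _; exact: nc_poly_sym.
Qed.

(** Induction principle: polynomials are the combinations of powers of creation
    operators, which are far easier to multiply than the [sym_op]. *)
Lemma nc_poly_sub A : op_subspace A ->
  (forall m c, A (iter m (creation c))) -> @nc_poly R d `<=` A.
Proof.
move=> Asub Ai _ [s ->]; apply: op_subspace_sum => // a _.
apply: op_subspaceZ => //; have [t ->] := @sym_op_span R d a.2.
by apply: op_subspace_sum => // b _; exact: op_subspaceZ.
Qed.

Lemma nc_poly_adjoint p : nc_poly p -> exists p', is_adjoint p p'.
Proof.
move: p; apply: nc_poly_sub => [|m c]; last first.
  by exists (iter m (annihilation c)); apply: is_adjoint_iter; exact: creation_adjoint.
split; first by exists 0 => x y; change (hdot (0 : F2) y = hdot x (0 : F2)); rewrite hdot0l hdot0r.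
move=> a T U [T' TT'] [U' UU']; exists (a^* *: T' + U'); exact: is_adjoint_lin.
Qed.

Lemma creation_bound c (r : C) : 0 <= r -> \sum_j `|c j| ^+ 2 <= r ^+ 2 ->
  op_bound r (creation c).
Proof.
move=> r0 cr x; rewrite -(@ler_pXn2r _ 2%N)// ?nnegrE ?mulr_ge0//.
by rewrite norm_creation exprMn ler_wpM2r// exprn_ge0.
Qed.

Lemma bounded_op_comp T U : bounded_op T -> bounded_op U -> bounded_op (T \o U).
Proof.
move=> bT bU; split; first by move=> a x y; rewrite /= bU.1 bT.1.
have [M M0 TM] := bounded_op_le bT; have [N N0 UN] := bounded_op_le bU.
exists (M * N) => x; apply: le_trans (TM _) _.
by rewrite -mulrA ler_wpM2l.
Qed.

Lemma bounded_op_id : bounded_op (@idfun F2).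
Proof. by split => //; exists 1 => x; rewrite mul1r. Qed.

Lemma bounded_op_iter m T : bounded_op T -> bounded_op (iter m T).
Proof.
move=> bT; elim: m => [|m ih]; first exact: bounded_op_id.
by have := bounded_op_comp bT ih.
Qed.

Lemma bounded_op_creation c : bounded_op (creation c).
Proof.
split; first exact: creation_linear.
have s0 : 0 <= \sum_j `|c j| ^+ 2 by apply: sumr_ge0 => j _; rewrite exprn_ge0.
by exists (sqrtC (\sum_j `|c j| ^+ 2)); apply: creation_bound; rewrite ?sqrtC_ge0 ?sqrtCK.
Qed.

Lemma nc_poly_bounded p : nc_poly p -> bounded_op p.
Proof.
move: p; apply: nc_poly_sub; first exact: bounded_op_subspace.
by move=> m c; apply: bounded_op_iter; exact: bounded_op_creation.
Qed.

Lemma nc_poly_id : nc_poly (@idfun F2).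
Proof. exact: (nc_poly_iter 0 (fun=> 0)). Qed.

Lemma sym_space_subspace : op_subspace (@sym_space R d).
Proof. exact: norm_closure_subspace nc_poly_subspace. Qed.

Lemma nc_poly_sym_space : @nc_poly R d `<=` @sym_space R d.
Proof. apply: sub_norm_closure; exact: nc_poly_bounded. Qed.

Lemma sym_space_adjoint p : sym_space p -> is_adjoint p (adjoint p).
Proof.
move=> Sp; have [p' pp'] := norm_closure_adjoint nc_poly_adjoint Sp.
by rewrite (adjointE pp').
Qed.

Lemma op_system_sym p : sym_space p -> op_system p.
Proof.
move=> Sp; exists p => //; exists 0; last by rewrite addr0.
exists 0; first exact: sym_space_subspace.1.
by apply: adjointE => x y; change (hdot (0 : F2) y = hdot x (0 : F2)); rewrite hdot0l hdot0r.
Qed.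

Lemma op_system_adjoint p : sym_space p -> op_system (adjoint p).
Proof.
move=> Sp; exists 0; first exact: sym_space_subspace.1.
by exists (adjoint p); [exists p|rewrite add0r].
Qed.

Lemma op_system_subspace : op_subspace (@op_system R d).
Proof.
split; first exact: op_system_sym sym_space_subspace.1.
move=> a _ _ [p Sp [_ [q Sq <-] <-]] [p1 Sp1 [_ [q1 Sq1 <-] <-]].
exists (a *: p + p1); first exact: sym_space_subspace.2.
exists (a *: adjoint q + adjoint q1); last by rewrite scalerDr addrACA.
exists (a^* *: q + q1); first exact: sym_space_subspace.2.
apply: adjointE; have := is_adjoint_lin a^* (sym_space_adjoint Sq) (sym_space_adjoint Sq1).
by rewrite conjCK.
Qed.

Lemma is_adjoint_bounded T T' : is_adjoint T T' -> bounded_op T -> bounded_op T'.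
Proof.
move=> TT' bT; split; first exact: is_adjoint_linear (is_adjoint_sym TT').
by have [M M0 TM] := bounded_op_le bT; exists M; exact: is_adjoint_bound TM.
Qed.

Lemma op_system_bounded : @op_system R d `<=` @bounded_op _ F2.
Proof.
move=> _ [p [bp _] [_ [q Sq <-] <-]].
rewrite -[p]scale1r; apply: bounded_op_subspace.2 => //.
exact: is_adjoint_bounded (sym_space_adjoint Sq) Sq.1.
Qed.

Lemma iter_annihilation_creation c c' m f :
  iter m (annihilation c) (iter m (creation c') f) = (\sum_j (c j)^* * c' j) ^+ m *: f.
Proof.
elim: m f => [|m ih] f; first by rewrite scale1r.
rewrite iterSr iterS annihilation_creation.
rewrite (linear_opZ (is_adjoint_linear (is_adjoint_iter m (is_adjoint_sym (creation_adjoint c))))).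
by rewrite ih scalerA -exprS.
Qed.

(** For powers, [(A_c^n)^* A_c'^m] is the scalar [<c, c'> ^ min(n, m)] times
    [A_c'^(m - n)] or [(A_c^(n - m))^*]; the product is sesquilinear in the
    polynomials, so [nc_poly_sub] gives the rest. *)
Lemma op_system_prod p q q' : nc_poly p -> nc_poly q -> is_adjoint q q' ->
  op_system (q' \o p).
Proof.
move=> np nq; move: p np q'.
suff h : forall p, nc_poly p -> exists2 q', is_adjoint q q' & op_system (q' \o p).
  move=> p np q' qq'; have [q1 qq1 ?] := h p np.
  by rewrite (is_adjoint_unique qq' qq1).
move: q nq; apply: nc_poly_sub.
  split=> [p np|a T U hT hU p np].
    exists 0; last exact: op_system_subspace.1.
    by move=> x y; change (hdot (0 : F2) y = hdot x (0 : F2)); rewrite hdot0l hdot0r.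
  have [T' TT' sT] := hT p np; have [U' UU' sU] := hU p np.
  exists (a^* *: T' + U'); first exact: is_adjoint_lin.
  exact: op_system_subspace.2.
move=> n c p np; set An := iter n (annihilation c).
have adj : is_adjoint (iter n (creation c)) An.
  by apply: is_adjoint_iter; exact: creation_adjoint.
have A_lin : linear An := is_adjoint_linear (is_adjoint_sym adj).
suff h : op_system (An \o p) by exists An.
have A_bounded := is_adjoint_bounded adj (nc_poly_bounded (nc_poly_iter n c)).
move: p np; apply: (nc_poly_sub (A := fun p => op_system (An \o p))).
  split.
    rewrite (_ : _ \o _ = 0); first exact: op_system_subspace.1.
    by apply/funext => x /=; have := linear_opZ A_lin 0 0; rewrite !scale0r.
  move=> a T U sT sU; rewrite (_ : _ \o _ = a *: (An \o T) + (An \o U)).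
    exact: op_system_subspace.2.
  by apply/funext => x; rewrite /= !fctE A_lin.
move=> m c'; set al := \sum_j (c j)^* * c' j.
have [nm|mn] := leqP n m.
  rewrite (_ : _ \o _ = al ^+ n *: iter (m - n) (creation c')).
    apply: op_subspaceZ op_system_subspace _.
    by apply: op_system_sym; apply: nc_poly_sym_space; exact: nc_poly_iter.
  apply/funext => x; rewrite /= -[X in iter X _ x](subnKC nm) iterD.
  exact: iter_annihilation_creation.
have adj' : is_adjoint (iter (n - m) (creation c)) (iter (n - m) (annihilation c)).
  by apply: is_adjoint_iter; exact: creation_adjoint.
rewrite (_ : _ \o _ = al ^+ m *: adjoint (iter (n - m) (creation c))).
  apply: op_subspaceZ op_system_subspace _.
  by apply: op_system_adjoint; apply: nc_poly_sym_space; exact: nc_poly_iter.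
apply/funext => x; rewrite (adjointE adj') /= /An -[X in iter X _ _](subnK (ltnW mn)) iterD.
rewrite iter_annihilation_creation -/al.
by rewrite (linear_opZ (is_adjoint_linear (is_adjoint_sym adj'))).
Qed.

(** Approximating [p] by a polynomial [q] within [t] changes [p^* p] by at most
    [t (2 M + 1)], where [M] bounds [p]. *)
Lemma norm_closure_gram p : sym_space p ->
  norm_closure (@op_system R d) (adjoint p \o p).
Proof.
move=> Sp; have adj := sym_space_adjoint Sp.
have [M M0 pM] := bounded_op_le Sp.1.
split; first exact: bounded_op_comp (is_adjoint_bounded adj Sp.1) Sp.1.
move=> e e0; pose N := M + (M + 1).
have N1 : 1 <= N by rewrite /N addrA lerDr addr_ge0.
have N0 : 0 < N := lt_le_trans ltr01 N1.
(* both [t <= 1], which keeps [q] bounded by [M + 1], and [t * N <= e] *)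
pose t : C := e / (N + e).
have Ne0 : 0 < N + e by rewrite addr_gt0.
have t0 : 0 < t by rewrite divr_gt0.
have t1 : t <= 1 by rewrite ler_pdivrMr// mul1r lerDr ltW.
have tN : t * N <= e.
  by rewrite mulrAC ler_pdivrMr// ler_pM2l// lerDl ltW.
have [q nq pq] := Sp.2 _ t0; have [q' qq'] := nc_poly_adjoint nq.
exists (q' \o q); first exact: (op_system_prod nq nq qq').
move=> x; rewrite /=.
have adj_t : op_bound t (-1 *: q' + adjoint p).
  have adj2 : is_adjoint (-1 *: q + p) (-1 *: q' + adjoint p).
    by have := is_adjoint_lin (-1) qq' adj; rewrite rmorphN rmorph1.
  apply: is_adjoint_bound (ltW t0) adj2 _ => y.
  by rewrite !fctE scaleN1r addrC.
have qM : `|q x| <= (M + 1) * `|x|.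
  rewrite -[q x](subKr (p x)); apply: le_trans (ler_normB _ _) _.
  rewrite mulrDl lerD//; apply: le_trans (pq x) _.
  by rewrite ler_wpM2r.
rewrite (_ : _ - _ = adjoint p (p x - q x) + (-1 *: q' + adjoint p) (q x)); last first.
  have lin := is_adjoint_linear (is_adjoint_sym adj).
  have -> : adjoint p (p x - q x) = adjoint p (p x) - adjoint p (q x).
    by rewrite addrC -scaleN1r lin scaleN1r addrC.
  by rewrite !fctE scaleN1r [RHS]addrACA addNr addr0.
apply: le_trans (ler_normD _ _) _.
apply: (@le_trans _ _ (t * N * `|x|)); last by rewrite ler_wpM2r.
rewrite /N mulrDr mulrDl lerD//.
  apply: le_trans (is_adjoint_bound M0 adj pM _) _.
  by rewrite (mulrC t) -mulrA ler_wpM2l.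
apply: le_trans (adj_t _) _.
by rewrite -mulrA ler_wpM2l// ltW.
Qed.

Lemma functional0 A mu : op_subspace A -> positive_functional A mu -> mu 0 = 0.
Proof.
move=> [A0 _] [mu_lin _]; have := mu_lin (-1) 0 0 A0 A0.
by rewrite scaler0 addr0 mulN1r addNr.
Qed.

Lemma functionalZ A mu a T : op_subspace A -> positive_functional A mu ->
  A T -> mu (a *: T) = a * mu T.
Proof.
move=> Asub muA AT; rewrite -[_ *: _]addr0 muA.1//; last exact: Asub.1.
by rewrite (functional0 Asub muA) addr0.
Qed.

(** Apply positivity to [M^2 I - p^* p]. *)
Lemma functional_gram_bound mu p (M : C) :
  positive_functional (norm_closure (@op_system R d)) mu ->
  sym_space p -> 0 <= M -> op_bound M p ->
  mu (adjoint p \o p) <= M ^+ 2 * mu idfun.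
Proof.
move=> mu_pos Sp M0 pM.
have Asub := norm_closure_subspace op_system_subspace.
have Aid : norm_closure (@op_system R d) idfun.
  apply: sub_norm_closure; first exact: op_system_bounded.
  by apply: op_system_sym; apply: nc_poly_sym_space; exact: nc_poly_id.
have Ap := norm_closure_gram Sp.
have AM : norm_closure (@op_system R d) (M ^+ 2 *: idfun) := op_subspaceZ _ Asub Aid.
rewrite -subr_ge0 -(functionalZ _ Asub mu_pos Aid) addrC -mulN1r.
rewrite -(mu_pos.1 (-1) _ _ Ap AM).
apply: mu_pos.2; first exact: Asub.2.
move=> x; rewrite !fctE hdotDl !hdotZl mulN1r addrC subr_ge0.
change (hdot (adjoint p (p x)) x <= M ^+ 2 * hdot x x).
rewrite (is_adjoint_sym (sym_space_adjoint Sp)) !hdotE -exprMn.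
by rewrite lerXn2r// nnegrE ?mulr_ge0.
Qed.

End OperatorSystem.

(** * The operators K_z *)

Section SzegoOperators.
Context {R : realType} {d : nat}.
Local Notation C := (Cplx R).
Local Notation F2 := (ell2 R d).
Local Notation ball := (unit_ball R d).
Implicit Types z w : ball.

(** The coefficients of the creation operator whose adjoint is [zLadj z]. *)
Definition conj_coord z (j : 'I_d) : C := (val z 0 j)^*.

Definition radius z : C := sqrtC (\sum_j `|val z 0 j| ^+ 2).

Lemma radius_ge0 z : 0 <= radius z.
Proof. by rewrite sqrtC_ge0; apply: sumr_ge0 => j _; rewrite exprn_ge0. Qed.

Lemma radius_lt1 z : radius z < 1.
Proof.
rewrite -(@ltr_pXn2r _ 2%N)// ?nnegrE ?radius_ge0// sqrtCK expr1n.
exact: (valP z).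
Qed.

Lemma sum_conj_coord z : \sum_j `|conj_coord z j| ^+ 2 = radius z ^+ 2.
Proof. by rewrite sqrtCK; apply: eq_bigr => j _; rewrite norm_conjC. Qed.

Lemma zLadjE z : zLadj z = annihilation (conj_coord z).
Proof.
apply: eq_bigr => j _; rewrite /conj_coord conjCK; congr (_ *: _).
exact: adjointE (shift_adjoint j).
Qed.

Lemma hermE z w : herm z w = \sum_j (conj_coord z j)^* * conj_coord w j.
Proof. by apply: eq_bigr => j _; rewrite /conj_coord conjCK. Qed.

(** The operator [(I - \sum_j z_j^* L_j)^-1] (see [szego_spec]), defined as an
    adjoint so that it depends on [z] alone. *)
Definition szego z : F2 -> F2 := adjoint (resolvent z).

(** The radius [r] is free: the estimate is used for the dilates [t z] with the
    sharp value [t * radius z]. *)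
Lemma szego_spec z r : 0 <= r -> r < 1 -> radius z <= r ->
  [/\ is_adjoint (szego z) (resolvent z),
      forall x, szego z x - creation (conj_coord z) (szego z x) = x,
      (forall x, resolvent z (x - zLadj z x) = x) /\
      (forall x, resolvent z x - zLadj z (resolvent z x) = x) &
      forall n x, `|szego z x - \sum_(k < n) iter k (creation (conj_coord z)) x|
         <= r ^+ n / (1 - r) * `|x|].
Proof.
move=> r0 r1 zr.
have adj := creation_adjoint (conj_coord z).
have crea_r : op_bound r (creation (conj_coord z)).
  apply: creation_bound => //; rewrite sum_conj_coord.
  by rewrite lerXn2r// nnegrE ?radius_ge0.
have anni_r := is_adjoint_bound r0 adj crea_r.
have [K [K_lin AK KA K_le]] := neumann (creation_linear _) r0 r1 crea_r.
have [S [S_lin AS SA S_le]] := neumann (annihilation_linear _) r0 r1 anni_r.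
have resE : resolvent z = S.
  apply: inverse_opE.
  - split=> //; exists (1 / (1 - r)) => x.
    by have := S_le 0 x; rewrite big_ord0 subr0.
  - by apply/funext => x; rewrite /= zLadjE -[RHS]SA.
  - by apply/funext => x; rewrite /= zLadjE -[RHS]AS.
have KS : is_adjoint K S.
  by move=> x y; rewrite -{1}[y]AS hdotBr -adj -hdotBl AK.
have szE : szego z = K by rewrite /szego resE (adjointE (is_adjoint_sym KS)).
by rewrite szE resE zLadjE.
Qed.

Lemma szego_adjoint z : is_adjoint (szego z) (resolvent z).
Proof. by have [] := szego_spec (radius_ge0 z) (radius_lt1 z) (lexx _). Qed.

Lemma sym_space_szego z : @sym_space R d (szego z).
Proof.
have r0 := radius_ge0 z; have r1 := radius_lt1 z.
have [adj _ _ z_le] := szego_spec r0 r1 (lexx _).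
split.
  split; first exact: is_adjoint_linear adj.
  exists (1 / (1 - radius z)) => x.
  by have := z_le 0 x; rewrite big_ord0 subr0.
move=> e e0; have s0 : 0 < 1 - radius z by rewrite subr_gt0.
have [n ne] := rate_lt (cvg_geometricC r0 r1) (fun n => exprn_ge0 n r0) (mulr_gt0 e0 s0).
exists (\sum_(k < n) iter k (creation (conj_coord z))).
  by apply: op_subspace_sum nc_poly_subspace _ => k _; exact: nc_poly_iter.
move=> x; rewrite fct_sumE; apply: le_trans (z_le n x) _.
by rewrite ler_wpM2r// ler_pdivrMr// ltW.
Qed.

Lemma norm_herm_lt1 z w : `|herm z w| < 1.
Proof.
pose f : F2 := xi R [::].
have f0 : 0 < `|f|.
  rewrite normr_gt0; apply/eqP => /(congr1 (fun g : F2 => g [::])) /eqP.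
  by rewrite /= /xi_fun eqxx oner_eq0.
have bnd v : op_bound (radius v) (creation (conj_coord v)).
  by apply: creation_bound; rewrite ?radius_ge0// sum_conj_coord.
have := is_adjoint_bound (radius_ge0 z) (creation_adjoint _) (bnd z) (creation (conj_coord w) f).
rewrite annihilation_creation -hermE normrZ => h.
have h2 : `|herm z w| * `|f| <= radius z * radius w * `|f|.
  by apply: le_trans h _; rewrite -mulrA ler_wpM2l ?radius_ge0//; exact: bnd.
move: h2; rewrite ler_pM2r// => /le_lt_trans; apply.
by rewrite mulr_ilt1 ?radius_ge0 ?radius_lt1.
Qed.

Lemma herm_neq1 z w : 1 - herm z w != 0.
Proof.
rewrite subr_eq0; apply/eqP => h; have := norm_herm_lt1 z w.
by rewrite -h normr1 ltxx.
Qed.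

(** With [A = z L^*], [B = (w L^* )^*], [R = (I - A)^-1] and [K = (I - B)^-1], the
    identity is [R ((I - B) + (I - A) - (I - A) (I - B)) K = R (I - A B) K]
    together with [A B = z w^*]. *)
Lemma resolvent_szego z w : resolvent z \o szego w =
  (1 - herm z w)^-1 *: (resolvent z + (szego w - idfun)).
Proof.
have [adj _ [RA _] _] := szego_spec (radius_ge0 z) (radius_lt1 z) (lexx _).
have [_ BK _ _] := szego_spec (radius_ge0 w) (radius_lt1 w) (lexx _).
have R_lin := is_adjoint_linear (is_adjoint_sym adj).
have RB x y : resolvent z (x - y) = resolvent z x - resolvent z y.
  by rewrite addrC -scaleN1r R_lin scaleN1r addrC.
apply/funext => x; rewrite !fctE /=; set y := szego w x.
apply: (scalerI (herm_neq1 z w)); rewrite scalerA mulfV ?herm_neq1// scale1r.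
rewrite -{1 2}(BK x) -/y; set By := creation _ y.
have : resolvent z By = By + herm z w *: resolvent z y.
  have := RA By; rewrite RB zLadjE annihilation_creation -hermE (linear_opZ R_lin).
  by move=> /eqP; rewrite subr_eq => /eqP.
rewrite RB => ->; rewrite subKr scalerBl scale1r opprD.
by rewrite addrA addrAC subrK.
Qed.

End SzegoOperators.

(** * Totality of the vectors [K_z] *)

Section Totality.
Context {R : realType} {d : nat}.
Local Notation C := (Cplx R).
Local Notation F2 := (ell2 R d).
Local Notation ball := (unit_ball R d).
Context {mubar : (F2 -> F2) -> C} {P2 : P2_space mubar}.
Hypothesis mubar_pos : positive_functional (norm_closure (@op_system R d)) mubar.
Implicit Types (p q : F2 -> F2) (z w : ball).
Local Notation cls := (P2_class P2).

Lemma P2_class0 : cls 0 = 0.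
Proof.
have S0 := (@sym_space_subspace R d).1.
have := P2_class_linear P2 (-1) S0 S0.
by rewrite scaler0 addr0 scaleN1r addNr.
Qed.

Lemma P2_class_sum I (r : seq I) (F : I -> F2 -> F2) :
  (forall i, sym_space (F i)) -> cls (\sum_(i <- r) F i) = \sum_(i <- r) cls (F i).
Proof.
move=> SF; elim: r => [|i r ih]; first by rewrite !big_nil P2_class0.
rewrite !big_cons -ih.
have Sr := op_subspace_sum r (P := xpredT) (@sym_space_subspace R d) (fun i _ => SF i).
by have := P2_class_linear P2 1 (SF i) Sr; rewrite !scale1r.
Qed.

Lemma P2_class_bound p (M : C) : sym_space p -> 0 <= M -> op_bound M p ->
  `|cls p| <= M * sqrtC (mubar idfun).
Proof.
move=> Sp M0 pM.
have Aid : norm_closure (@op_system R d) idfun.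
  apply: sub_norm_closure; first exact: op_system_bounded.
  by apply: op_system_sym; apply: nc_poly_sym_space; exact: nc_poly_id.
have id0 : 0 <= mubar idfun.
  by apply: mubar_pos.2 => // x; change (0 <= hdot x x); rewrite hdotE exprn_ge0.
rewrite -(@ler_pXn2r _ 2%N)// ?nnegrE ?mulr_ge0 ?sqrtC_ge0//.
rewrite exprMn sqrtCK -hdotE (P2_class_dot P2 Sp Sp).
exact: functional_gram_bound mubar_pos Sp M0 pM.
Qed.

Lemma dilate_subproof n z : \sum_j `|(rate n *: val z) 0 j| ^+ 2 < 1.
Proof.
apply: le_lt_trans (valP z); apply: ler_sum => j _; rewrite mxE normrM.
rewrite lerXn2r ?nnegrE ?mulr_ge0// ler_piMl//.
by rewrite ger0_norm ?(ltW (rate_gt0 n))// invf_le1// ler1n.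
Qed.

Definition dilate n z : ball := exist _ (rate n *: val z) (dilate_subproof n z).

Lemma conj_coord_dilate n z :
  conj_coord (dilate n z) = (fun j => rate n * conj_coord z j).
Proof.
apply/funext => j; rewrite /conj_coord /= mxE rmorphM /=; congr (_ * _).
by rewrite geC0_conj// ltW// rate_gt0.
Qed.

Lemma radius_dilate n z : radius (dilate n z) = rate n * radius z.
Proof.
apply/eqP; rewrite -(@eqrXn2 _ 2%N)// ?radius_ge0 ?mulr_ge0 ?radius_ge0 ?(ltW (rate_gt0 n))//.
rewrite exprMn -!sum_conj_coord conj_coord_dilate mulr_sumr; apply/eqP.
apply: eq_bigr => j _; rewrite normrM exprMn ger0_norm// ltW//; exact: rate_gt0.
Qed.

(** By induction on [m]: once the Taylor coefficients below [m] are known to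
    vanish, [0 = <x, [K_(t z)]>] is [t^m] times the coefficient of order [m] up
    to [O(t^(m + 1))]; divide by [t^m] and let [t] tend to 0. *)
Lemma orth_power x z : (forall w, hdot x (cls (szego w)) = 0) ->
  forall m, hdot x (cls (iter m (creation (conj_coord z)))) = 0.
Proof.
move=> xz m; have [k] := ubnP m; elim: k m => // k ih m; rewrite ltnS => mk.
set T := creation (conj_coord z).
have r0 := radius_ge0 z; have r1 := radius_lt1 z; set r := radius z in r0 r1.
have s0 : 0 < 1 - r by rewrite subr_gt0.
apply: (@rate_le_eq0 _ C _ _ (`|x| * (sqrtC (mubar idfun) / (1 - r))) cvg_rate) => n.
set t := rate n; have t0 : 0 < t by exact: rate_gt0.
have t1 : t <= 1 by rewrite invf_le1// ler1n.
have tr1 : t * r < 1 by apply: le_lt_trans r1; rewrite ler_piMl.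
have tr0 : 0 <= t * r by rewrite mulr_ge0// ltW.
have zn_r : radius (dilate n z) <= t * r by rewrite radius_dilate.
have [_ _ _ tail_le] := szego_spec tr0 tr1 zn_r.
have iterE j : iter j (creation (conj_coord (dilate n z))) = t ^+ j *: iter j T.
  by rewrite conj_coord_dilate iter_creationZ.
(* the Taylor remainder of [K_(t z)] after order [m] *)
pose E := -1 *: (\sum_(j < m.+1) iter j (creation (conj_coord (dilate n z))))
  + szego (dilate n z).
have S_iter j c : @sym_space R d (iter j (creation c)).
  by apply: nc_poly_sym_space; exact: nc_poly_iter.
have S_sum : @sym_space R d (\sum_(j < m.+1) iter j (creation (conj_coord (dilate n z)))).
  by apply: op_subspace_sum sym_space_subspace _ => j _; exact: S_iter.
have S_szego := sym_space_szego (dilate n z).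
have SE : @sym_space R d E by exact: sym_space_subspace.2 S_sum S_szego.
have clsT j : cls (t ^+ j *: iter j T) = t ^+ j *: cls (iter j T).
  have := P2_class_linear P2 (t ^+ j) (S_iter j (conj_coord z)) sym_space_subspace.1.
  by rewrite P2_class0 !addr0.
have tE j : (t ^+ j)^* = t ^+ j by rewrite geC0_conj// exprn_ge0// ltW.
have xE : hdot x (cls E) = - (t ^+ m * hdot x (cls (iter m T))).
  rewrite (P2_class_linear P2 _ S_sum S_szego).
  rewrite scaleN1r hdotDr xz addr0 -scaleN1r hdotZr rmorphN rmorph1 mulN1r.
  rewrite (P2_class_sum _ (fun j => S_iter _ _)) hdot_sumr big_ord_recr /= big1 ?add0r => [|j _].
    by rewrite iterE clsT hdotZr tE.
  by rewrite iterE clsT hdotZr ih ?mulr0// (leq_trans (ltn_ord j)).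
have E_bound : op_bound (t ^+ m.+1 / (1 - r)) E.
  move=> f; rewrite /E !fctE scaleN1r addrC fct_sumE; apply: le_trans (tail_le _ f) _.
  rewrite ler_wpM2r// ler_pM ?exprn_ge0 ?invr_ge0 ?subr_ge0 ?(ltW tr1)//.
    by rewrite lerXn2r ?nnegrE ?(ltW t0)// ler_piMr// ltW.
  rewrite lef_pV2 ?posrE ?subr_gt0// lerD2l lerN2.
  by rewrite ler_piMl.
have M0 : 0 <= t ^+ m.+1 / (1 - r) by rewrite divr_ge0 ?exprn_ge0 ?(ltW t0) ?(ltW s0).
have := le_trans (norm_hdot x (cls E)) (ler_wpM2l (normr_ge0 x) (P2_class_bound SE M0 E_bound)).
rewrite xE normrN normrM ger0_norm ?exprn_ge0 ?(ltW t0)// => h.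
rewrite -(@ler_pM2l _ (t ^+ m)) ?exprn_gt0//; apply: le_trans h _.
by rewrite le_eqVlt; apply/orP; left; apply/eqP; rewrite exprS; ring.
Qed.

(** Orthogonality to the [K_z] passes to powers, by homogeneity to powers with
    arbitrary coefficients, to polynomials, to [S] by continuity of the class
    map, and to the whole space by density. *)
Lemma szego_total : total_family (fun z => cls (szego z)).
Proof.
move=> x xz.
pose A : set (F2 -> F2) := [set p | sym_space p /\ hdot x (cls p) = 0].
have A_sub : op_subspace A.
  split; first by split; [exact: sym_space_subspace.1|rewrite P2_class0 hdot0r].
  move=> a T U [ST xT] [SU xU]; split; first exact: sym_space_subspace.2 ST SU.
  by rewrite (P2_class_linear P2 _ ST SU) hdotDr hdotZr xT xU mulr0 addr0.
have A_poly : @nc_poly R d `<=` A.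
  apply: nc_poly_sub => // m c; split.
    by apply: nc_poly_sym_space; exact: nc_poly_iter.
  (* scale the coefficients into the ball *)
  pose s := sqrtC (\sum_j `|c j| ^+ 2) + 1.
  have c0 : 0 <= \sum_j `|c j| ^+ 2 by apply: sumr_ge0 => j _; rewrite exprn_ge0.
  have s0 : 0 < s by rewrite ltr_wpDl ?sqrtC_ge0.
  have zP : \sum_j `|(\row_j (s^-1 * c j)^*) 0 j| ^+ 2 < 1.
    under eq_bigr => j _ do rewrite mxE norm_conjC normrM exprMn.
    rewrite -mulr_sumr ger0_norm ?invr_ge0 ?(ltW s0)// exprVn mulrC.
    rewrite ltr_pdivrMr ?exprn_gt0// mul1r -[ltLHS]sqrtCK.
    by rewrite ltr_pXn2r ?nnegrE ?sqrtC_ge0 ?(ltW s0)// ltrDl.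
  pose z : ball := exist _ (\row_j (s^-1 * c j)^*) zP.
  have cE : c = fun j => s * conj_coord z j.
    apply/funext => j; rewrite /conj_coord /= mxE conjCK mulrA mulfV ?mul1r//.
    by rewrite gt_eqF.
  have := orth_power z xz m; rewrite {1}cE iter_creationZ => xm.
  have Sm := nc_poly_sym_space (nc_poly_iter m (conj_coord z)).
  have := P2_class_linear P2 (s ^+ m) Sm sym_space_subspace.1.
  by rewrite P2_class0 !addr0 => ->; rewrite hdotZr xm mulr0.
have A_sym p : sym_space p -> hdot x (cls p) = 0.
  move=> Sp; apply: (@rate_le_eq0 _ C _ _ (`|x| * sqrtC (mubar idfun)) cvg_rate) => n.
  have [q nq pq] := Sp.2 _ (rate_gt0 n).
  have [Sq xq] := A_poly _ nq.
  have -> : hdot x (cls p) = hdot x (cls (-1 *: q + p)).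
    by rewrite (P2_class_linear P2 _ Sq Sp) hdotDr hdotZr xq mulr0 add0r.
  have S' : sym_space (-1 *: q + p) by exact: sym_space_subspace.2 Sq Sp.
  have bnd : op_bound (rate n) (-1 *: q + p).
    by move=> f; rewrite !fctE scaleN1r addrC; exact: pq.
  apply: le_trans (norm_hdot _ _) _; rewrite -mulrA (mulrC (sqrtC _)) ler_wpM2l//.
  exact: P2_class_bound S' (ltW (rate_gt0 n)) bnd.
apply: hdot_sep => y; have : closure (cls @` @sym_space R d) y by rewrite P2_class_dense.
move=> y_cl; apply: (@rate_le_eq0 _ C _ _ `|x| cvg_rate) => n.
have [_ [[p Sp <-]]] := y_cl _ (nbhsx_ballx y _ (rate_gt0 n)).
rewrite -ball_normE /= => /ltW yp.
have -> : hdot x y = hdot x (y - cls p) by rewrite hdotBr A_sym// subr0.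
by apply: le_trans (norm_hdot _ _) _; rewrite ler_wpM2l.
Qed.

End Totality.

(** * The Gram matrix of the vectors [K_z], and the transform *)

Section GramMatrix.
Context {R : realType} {d : nat}.
Local Notation C := (Cplx R).
Local Notation F2 := (ell2 R d).
Local Notation ball := (unit_ball R d).
Implicit Types z w : ball.

(** If [b z0 = 1], then [k], the kernel at [z0], satisfies [<b k, k> = |k|^2] while
    [|b k| <= |k|]; so [b k = k], and [k] has no zero. *)
Lemma contractive_multiplier_neq1 (H2 : rkhs (@drury_arveson_kernel R d))
    (b : ball -> C) : contractive_multiplier H2 b -> (exists z, b z <> 1) ->
  forall z, b z != 1.
Proof.
move=> [_ b_contr] [z1 bz1] z0; apply/eqP => bz0; apply: bz1.
have [k kE k_rep] := rkhs_reproducing H2 z0.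
have [g gE g_le] := b_contr k.
have gk : hdot g k = `|k| ^+ 2.
  by rewrite -k_rep gE bz0 mul1r k_rep hdotE.
have : `|g - k| ^+ 2 <= 0.
  rewrite -hdotE hdotBl !hdotBr (hdot_conj k) gk !hdotE.
  rewrite geC0_conj ?exprn_ge0// subrr subr0 subr_le0.
  by rewrite lerXn2r// nnegrE.
move=> le0; have : `|g - k| ^+ 2 == 0 by rewrite eq_le le0 exprn_ge0.
rewrite sqrf_eq0 normr_eq0 subr_eq0 => /eqP gkE.
have := congr1 (fun f => f z1) gE; rewrite gkE kE /drury_arveson_kernel.
move=> /eqP; rewrite -{1}[_^-1]mul1r => /eqP /(mulIf (invr_neq0 (herm_neq1 z1 z0))).
by [].
Qed.

Section Represented.
Context {b : ball -> C} {mu mubar : (F2 -> F2) -> C} {P2 : P2_space mubar}.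
Hypothesis mu_state : state mu.
Hypothesis mu_repr : represents mu b.
Hypothesis mubar_ext : state_extension mu mubar.
Hypothesis b_neq1 : forall z, b z != 1.

Let S_id : @sym_space R d idfun.
Proof. by apply: nc_poly_sym_space; exact: nc_poly_id. Qed.

Let sys_id : @op_system R d idfun.
Proof. exact: op_system_sym S_id. Qed.

Let sys_res z : @op_system R d (resolvent z).
Proof.
rewrite -(adjointE (szego_adjoint z)); apply: op_system_adjoint.
exact: sym_space_szego.
Qed.

(** The state is hermitian: both values are inner products of the classes of [I]
    and [K_z], in the two orders. *)
Lemma state_szego z : mu (szego z) = (mu (resolvent z))^*.
Proof.
have S_z := sym_space_szego z.
have sys_z := op_system_sym S_z.
rewrite -!mubar_ext.2//.
rewrite (_ : szego z = adjoint idfun \o szego z); last first.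
  by rewrite (adjointE is_adjoint_id).
rewrite (_ : resolvent z = adjoint (szego z) \o idfun); last first.
  by rewrite (adjointE (szego_adjoint z)).
rewrite -(P2_class_dot P2 S_z S_id) -(P2_class_dot P2 S_id S_z).
exact: hdot_conj.
Qed.

Lemma state_id_ge0 : 0 <= mu idfun.
Proof.
apply: mu_state.2; first exact: sys_id.
by move=> x; change (0 <= hdot x x); rewrite hdotE exprn_ge0.
Qed.

(** The Herglotz kernel is [(I + A) (I - A)^-1 = 2 (I - A)^-1 - I]. *)
Lemma state_resolvent z : (1 + b z) / (1 - b z) =
  2 * mu (resolvent z) - mu idfun + 'i * 'Im ((1 + b (unit_ball0 R d)) / (1 - b (unit_ball0 R d))).
Proof.
rewrite mu_repr; congr (_ + _).
have [_ _ [_ AR] _] := szego_spec (radius_ge0 z) (radius_lt1 z) (lexx _).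
rewrite (_ : _ \o _ = 2 *: resolvent z + (-1) *: idfun).
  rewrite (mu_state.1 2 _ _ (sys_res z)); last exact: op_subspaceZ op_system_subspace sys_id.
  by rewrite (functionalZ (-1) op_system_subspace mu_state sys_id) mulN1r.
apply/funext => x; rewrite !fctE /= scaleN1r.
rewrite -[X in _ = _ - X](AR x) opprB scaler_nat mulr2n -addrA; congr (_ + _).
by rewrite [RHS]addrC subrK.
Qed.

(** Adding the Herglotz formula at [z] to the conjugate of the one at [w] cancels
    the imaginary constant and leaves twice [mu (R_z + K_w - I)]. *)
Lemma gram_szego w z :
  hdot (P2_class P2 (szego w)) (P2_class P2 (szego z)) =
  dbr_kernel b z w / ((1 - b z) * (1 - b w)^*).
Proof.
have S_z := sym_space_szego z; have S_w := sym_space_szego w.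
have sys_w := op_system_sym S_w.
have sys_wi : @op_system R d (szego w - idfun).
  by rewrite addrC -scaleN1r; exact: op_system_subspace.2.
have sys_sum : @op_system R d (resolvent z + (szego w - idfun)).
  by rewrite -[resolvent z]scale1r; exact: op_system_subspace.2.
rewrite (P2_class_dot P2 S_w S_z) (adjointE (szego_adjoint z)) resolvent_szego.
rewrite mubar_ext.2; last exact: op_subspaceZ op_system_subspace sys_sum.
rewrite (functionalZ _ op_system_subspace mu_state sys_sum).
have -> : mu (resolvent z + (szego w - idfun)) =
    mu (resolvent z) + (mu (resolvent w))^* - mu idfun.
  rewrite -{1}[resolvent z]scale1r (mu_state.1 1 _ _ (sys_res z) sys_wi) mul1r.
  rewrite -addrA; congr (_ + _); rewrite -state_szego [szego w - _]addrC -scaleN1r.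
  by rewrite (mu_state.1 (-1) _ _ sys_id sys_w) mulN1r addrC.
have [c cJ herglotz] : exists2 c : C, c^* = - c &
    forall z, (1 + b z) / (1 - b z) = 2 * mu (resolvent z) - mu idfun + c.
  exists ('i * 'Im ((1 + b (unit_ball0 R d)) / (1 - b (unit_ball0 R d)))).
    by rewrite rmorphM /= conjCi (CrealP (Creal_Im _)) mulNr.
  exact: state_resolvent.
have nJ : (mu idfun)^* = mu idfun by rewrite geC0_conj// state_id_ge0.
have hz := herglotz z; have := congr1 Num.conj (herglotz w).
rewrite rmorphD rmorphB !rmorphM /= fmorphV rmorphD rmorphB /= rmorph1.
rewrite rmorph_nat nJ cJ => hw.
have bz : 1 - b z != 0 by rewrite subr_eq0 eq_sym.
have bw : 1 - (b w)^* != 0.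
  have -> : 1 - (b w)^* = (1 - b w)^* by rewrite rmorphB rmorph1.
  by rewrite conjC_eq0 subr_eq0 eq_sym.
have -> : mu (resolvent z) + (mu (resolvent w))^* - mu idfun =
    ((1 + b z) / (1 - b z) + (1 + (b w)^*) / (1 - (b w)^*)) / 2.
  by rewrite hz hw; field.
rewrite /dbr_kernel rmorphB rmorph1 /=; field.
by rewrite bz bw herm_neq1.
Qed.

End Represented.
End GramMatrix.

Theorem theorem2p8 (R : realType) (d : nat) (d_ge1 : (1 <= d)%N)
    (H2 : rkhs (@drury_arveson_kernel R d)) (b : unit_ball R d -> Cplx R)
    (b_mult : contractive_multiplier H2 b) (b_neq1 : exists z, b z <> 1)
    (Hb : rkhs (dbr_kernel b))
    (mu mubar : (ell2 R d -> ell2 R d) -> Cplx R)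
    (mu_state : state mu) (mu_repr : represents mu b)
    (mubar_ext : state_extension mu mubar)
    (P2 : P2_space mubar) :
  exists U : {linear P2 -> Hb}, unitary U /\
    forall p, nc_poly p -> rkhs_fun Hb (U (P2_class P2 p)) = fantappie mubar b p.
Proof.
have bz1 := contractive_multiplier_neq1 b_mult b_neq1.
have bJ z : (1 - b z)^* != 0 by rewrite conjC_eq0 subr_eq0 eq_sym.
have /choice[kb kbP] w : exists kw : Hb,
    rkhs_fun Hb kw = (dbr_kernel b)^~ w /\ forall f, rkhs_fun Hb f w = hdot f kw.
  by have [kw] := rkhs_reproducing Hb w; exists kw.
pose v z : Hb := ((1 - b z)^*)^-1 *: kb z.
have hdot_kb f z : hdot f (kb z) = (1 - b z) * hdot f (v z).
  rewrite hdotZr fmorphV /= conjCK mulrA mulfV ?mul1r//.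
  by rewrite subr_eq0 eq_sym.
have v_total : total_family v.
  move=> f fv; apply: (@rkhs_fun_inj _ _ _ Hb).
  apply/funext => z; rewrite (kbP z).2 hdot_kb fv mulr0.
  by rewrite linear0.
have gram w z : hdot (P2_class P2 (szego w)) (P2_class P2 (szego z)) = hdot (v w) (v z).
  rewrite (gram_szego mu_state mu_repr mubar_ext bz1).
  rewrite hdotZl hdotZr -(kbP z).2 (kbP w).1 fmorphV /= conjCK.
  by rewrite invfM mulrC -mulrA mulrCA mulrA.
have [U [U_unitary U_v]] := unitary_of_gram (szego_total mubar_ext.1) v_total gram.
exists U; split=> // p np; apply/funext => z.
rewrite (kbP z).2 hdot_kb U_v /fantappie.
rewrite (P2_class_dot P2 (nc_poly_sym_space np) (sym_space_szego z)).
by rewrite (adjointE (szego_adjoint z)).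
Qed.
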